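(* Let $\mathcal{H}$ and $\widetilde{\mathcal{H}}$ be (real or complex) separable Hilbert spaces and let $\widetilde{\mathbf{A}}$ be a normal operator on $\widetilde{\mathcal{H}}$ with unique self-adjoint resolution of identity $\mathsf{E}$. Let $\Lambda:\widetilde{\mathcal{H}}\to\mathcal{H}$ be a bounded linear operator that is proper with respect to $\mathsf{E}$, i.e. $\mathrm{Ran}(\Lambda)$ is dense in $\mathcal{H}$ and $\mathsf{E}_\Omega\big(\overline{\mathrm{Ran}(\Lambda^* )}\big)\subseteq\overline{\mathrm{Ran}(\Lambda^* )}$ for every Borel $\Omega\subseteq\mathbb{C}$. Define $$\mathsf{F}_\Omega=\Lambda\mathsf{E}_\Omega\Lambda^\dagger,\qquad\Omega\subseteq\mathbb{C}\text{ Borel}.$$ Then $\mathsf{F}$ is a non-self-adjoint (nsa) resolution of identity on $\mathcal{H}$ with domain $\mathrm{Ran}(\Lambda)$ and, for $(f,g)\in\mathrm{Ran}(\Lambda)\times\mathcal{H}$, the following hold. (1) The measure $\gamma\mapsto\langle\mathsf{F}_\gamma f,g\rangle_{\mathcal{H}}$ is of bounded variation, and equals $\gamma\mapsto\langle\mathsf{E}_\gamma\Lambda^\dagger f,\Lambda^*g\rangle_{\widetilde{\mathcal{H}}}$. (2) For each $m\in L^\infty(\sigma(\widetilde{\mathbf{A}}))$ there exists a unique closed, densely-defined linear operator $\int_{\sigma(\widetilde{\mathbf{A}})}m(\gamma)d\mathsf{F}_\gamma$ with domain $\mathrm{Ran}(\Lambda)$, which satisfies $$\Big\langle\Big(\int_{\sigma(\widetilde{\mathbf{A}})}m(\gamma)d\mathsf{F}_\gamma\Big)f,g\Big\rangle_{\mathcal{H}}=\langle\Lambda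 m(\widetilde{\mathbf{A}})\Lambda^\dagger f,g\rangle_{\mathcal{H}}=\int_{\sigma(\widetilde{\mathbf{A}})}m(\gamma)d\langle\mathsf{F}_\gamma f,g\rangle_{\mathcal{H}}.$$ (3) For any $m\in L^\infty(\sigma(\widetilde{\mathbf{A}}))$, $$\int_{\sigma(\widetilde{\mathbf{A}})}|m(\gamma)|\,d|\langle\mathsf{F}_\gamma f,g\rangle_{\mathcal{H}}|=\int_{\sigma(\widetilde{\mathbf{A}})}d\big|\langle\mathsf{F}_\gamma\Lambda m(\widetilde{\mathbf{A}})\Lambda^\dagger f,g\rangle_{\mathcal{H}}\big|.$$ (4) For $m_1,m_2\in L^\infty(\sigma(\widetilde{\mathbf{A}}))$ we have, on $\mathrm{Ran}(\Lambda)$, the multiplicative property $$\Big(\int_{\sigma(\widetilde{\mathbf{A}})}m_1(\gamma)d\mathsf{F}_\gamma\Big)\Big(\int_{\sigma(\widetilde{\mathbf{A}})}m_2(\gamma)d\mathsf{F}_\gamma\Big)=\int_{\sigma(\widetilde{\mathbf{A}})}(m_1m_2)(\gamma)d\mathsf{F}_\gamma.$$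
   Context: For normal $\widetilde{\mathbf{A}}$, $\mathsf{E}$ is its unique projection-valued spectral measure on the Borel sets of $\mathbb{C}$, $\sigma(\widetilde{\mathbf{A}})$ is its spectrum, and $m(\widetilde{\mathbf{A}})=\int_{\sigma(\widetilde{\mathbf{A}})}m(\gamma)d\mathsf{E}_\gamma$. $L^\infty(\sigma(\widetilde{\mathbf{A}}))$ is the space of bounded complex-valued Borel functions on $\sigma(\widetilde{\mathbf{A}})$ with the uniform norm. For a complex measure $\nu$, $|\nu|$ denotes its total variation; thus $|\langle\mathsf{F}_\gamma f,g\rangle|$ is the total variation measure of $\Omega\mapsto\langle\mathsf{F}_\Omega f,g\rangle$. $\Lambda^\dagger$ is the (Moore–Penrose) pseudo-inverse of $\Lambda$, with domain $\mathrm{Ran}(\Lambda)$: for $f\in\mathrm{Ran}(\Lambda)$, $\Lambda^\dagger f$ is the unique $h\in\mathrm{Ker}(\Lambda)^\perp$ with $\Lambda h=f$. A nsa resolution of identity on $\mathcal{H}$ with domain $D$, where $D$ is dense in $\mathcal{H}$, is a map $\mathsf{F}$ from the Borel sets of $\mathbb{C}$ to the linear (not necessarily continuous) operators on $\mathcal{H}$ such that: (i) for each Borel $\Omega$, $\mathsf{F}_\Omega$ is a closed linear operator with domain $D$; (ii) for each Borel $\Omega$, $\mathsf{F}_\Omega\neq\mathsf{F}_\Omega^*$; (iii) $\mathsf{F}_\emptyset=0$, $\mathsf{F}_{\mathbb{C}}=I$, and $\mathsf{F}_{\Omega_1}\mathsf{F}_{\Omega_2}=\mathsf{F}_{\Omega_2}\mathsf{F}_{\Omega_1}=\mathsf{F}_{\Omega_1\cap\Omega_2}$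 for all Borel $\Omega_1,\Omega_2$; (iv) for a countable collection of pairwise disjoint Borel sets $(\Omega_i)_{i\ge1}$, $\mathsf{F}_{\cup_i\Omega_i}=\sum_{i=1}^\infty\mathsf{F}_{\Omega_i}$ in the strong operator topology.
   Formalization: As F_∅=0 is closed on dense Ran(Λ) only if Ran(Λ)=H, and is then self-adjoint, closedness of F_Ω and of ∫m dF is taken relative to the graph topology of Λ† (literal closedness if Ran(Λ)=H), and F_Ω≠F_Ω* is claimed only when Ran(Λ)≠H. *)

(* Defs.v *)
From HB Require Import structures.
From mathcomp Require Import all_boot all_order all_algebra.
From mathcomp Require Import sesquilinear complex.
From mathcomp Require Import all_classical all_reals all_analysis.

Set Implicit Arguments.
Unset Strict Implicit.
Unset Printing Implicit Defensive.

Import Order.TTheory GRing.Theory Num.Theory numFieldNormedType.Exports.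

Local Open Scope classical_set_scope.
Local Open Scope ring_scope.

(** * Hilbert spaces *)

(* The inner product is linear in its first argument and [theta]-semilinear in
   the second; [theta] is [idfun] for real spaces and [Num.conj] for complex
   ones. *)
Record hilbertType (K : numFieldType) (theta : K -> K) := HilbertType {
  hilbert_sort :> completeNormedModType K;
  hilbert_dot : {dot hilbert_sort for theta};
  hilbert_dotE : forall u, hilbert_dot u u = `|u| ^+ 2 }.

Definition dotp (K : numFieldType) (theta : K -> K) (V : hilbertType theta)
  (u v : V) : K := hilbert_dot V u v.

Definition realHilbert (R : realType) := @hilbertType R idfun.
Definition complexHilbert (R : realType) := @hilbertType R[i] (@Num.conj R[i]).

Definition separable_space (T : topologicalType) :=
  exists S : set T, countable S /\ dense S.

(** * Unbounded operators *)

(* The values of [ofun] outside [odom] are irrelevant: operators are compared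
   through their graphs. *)
Record oper (V W : Type) := Oper { odom : set V; ofun :> V -> W }.

Definition graph V W (T : oper V W) : set (V * W) :=
  [set p | odom T p.1 /\ p.2 = T p.1].

Definition oeq V W (T S : oper V W) : Prop := graph T = graph S.
Notation "T =op S" := (oeq T S) (at level 70, no associativity).

Definition everywhere V W (f : V -> W) : oper V W := Oper setT f.

Definition ocomp U V W (S : oper V W) (T : oper U V) : oper U W :=
  Oper [set x | odom T x /\ odom S (T x)] (S \o T).

Definition olinear (K : numFieldType) (V W : lmodType K) (T : oper V W) :=
  odom T 0 /\ forall a x y, odom T x -> odom T y ->
    odom T (a *: x + y) /\ T (a *: x + y) = a *: T x + T y.

Definition closed_oper (K : numFieldType) (V W : normedModType K)
  (T : oper V W) := closed (graph T).

Section Operators.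
Variables (K : numFieldType) (theta : K -> K).
Implicit Types V W : hilbertType theta.

Definition adjoint_rel V W (T : oper V W) (g : W) (h : V) :=
  forall f, odom T f -> dotp (T f) g = dotp f h.

(* For a densely defined [T] there is at most one [h] with
   [adjoint_rel T g h]. *)
Definition adjoint V W (T : oper V W) : oper W V :=
  Oper [set g | exists h, adjoint_rel T g h]
       (fun g => xget 0 [set h | adjoint_rel T g h]).

Definition normal_oper V (T : oper V V) :=
  [/\ olinear T, dense (odom T), closed_oper T
    & ocomp (adjoint T) T =op ocomp T (adjoint T)].

Definition resolvent_set V (T : oper V V) : set K :=
  [set z | exists B : {linear V -> V},
    [/\ continuous B,
        forall y, odom T (B y) /\ T (B y) - z *: B y = y
      & forall x, odom T x -> B (T x - z *: x) = x]].

Definition spectrum V (T : oper V V) : set K := ~` resolvent_set T.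

Definition pseudo_inverse V W (L : V -> W) : oper W V :=
  Oper (range L)
       (fun f => xget 0 [set h | L h = f /\ forall k, L k = 0 -> dotp h k = 0]).

End Operators.

(** * Complex measures *)

Definition modC (R : realType) (z : R[i]) : R := complex.Re `|z|.

Definition Cborel (R : realType) : Type :=
  g_sigma_algebraType (@open R[i]^o).

Section ComplexMeasures.
Variable R : realType.
Local Notation C := (Cborel R).
Implicit Types (nu : set C -> R[i]) (D : set C).

(* The (positive measure, resp. finite signed measure) which agrees with a
   given set function on the Borel sets, and 0 if there is none. *)
Definition measure_of (mu : set C -> \bar R) : {measure set C -> \bar R} :=
  if pselect (exists mu' : {measure set C -> \bar R},
                forall A, measurable A -> mu' A = mu A) is left ex
  then sval (cid ex) else mzero.

Definition charge_of (mu : set C -> \bar R) : {charge set C -> \bar R} :=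
  if pselect (exists mu' : {charge set C -> \bar R},
                forall A, measurable A -> mu' A = mu A) is left ex
  then sval (cid ex) else czero.

(* Integral against a signed measure, through its Jordan decomposition. *)
Definition charge_integral (mu : {charge set C -> \bar R}) D (h : C -> R) : R :=
  let: exist P exN := cid (Hahn_decomposition mu) in
  let: exist N muPN := cid exN in
  Rintegral (jordan_pos muPN) D h - Rintegral (jordan_neg muPN) D h.

Definition is_cmeasure nu :=
  nu set0 = 0 /\
  forall A : (set C)^nat, (forall i, measurable (A i)) -> trivIset setT A ->
    (fun n => \sum_(i < n) nu (A i) : R[i]^o) @ \oo -->
      (nu (\bigcup_i A i) : R[i]^o).

(* int (a + ib) d(mu1 + i mu2)
     = int a dmu1 - int b dmu2 + i (int a dmu2 + int b dmu1) *)
Definition cmeasure_integral nu D (h : C -> C) : R[i] :=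
  let re := charge_of (fun A => (complex.Re (nu A))%:E) in
  let im := charge_of (fun A => (complex.Im (nu A))%:E) in
  let a z := complex.Re (h z : R[i]) in
  let b z := complex.Im (h z : R[i]) in
  ((charge_integral re D a - charge_integral im D b) +i*
   (charge_integral im D a + charge_integral re D b))%C.

Definition cmeasure_variation nu (A : set C) : \bar R :=
  ereal_sup [set x | exists B : (set C)^nat,
    [/\ forall i, measurable (B i), trivIset setT B, \bigcup_i B i = A
      & x = (\sum_(0 <= i <oo) (modC (nu (B i)))%:E)%E]].

Definition cmeasure_tv nu : {measure set C -> \bar R} :=
  measure_of (cmeasure_variation nu).

Definition bounded_borel D (m : C -> C) :=
  measurable_fun D m /\ exists M : R, forall z, D z -> modC (m z) <= M.

End ComplexMeasures.

(** * Resolutions of identity *)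

Section Resolutions.
Variables (R : realType) (H : complexHilbert R).
Local Notation C := (Cborel R).

Definition matrix_coeff (G : set C -> oper H H) (f g : H) (Om : set C) : R[i] :=
  dotp (G Om f) g.

(* Weak integral of [m] over [D]: [f] is mapped to the vector [w] such that
   [<w, g> = int_D m(z) d<G_z f, g>] for all [g]. *)
Definition oper_integral (G : set C -> oper H H) (D : set C) (m : C -> C) :
    oper H H :=
  let P f := [set w | forall g,
                dotp w g = cmeasure_integral (matrix_coeff G f g) D m] in
  Oper [set f | (forall Om, measurable Om -> odom (G Om) f) /\ P f !=set0]
       (fun f => xget 0 (P f)).

Record spectral_measure (E : set C -> {linear H -> H}) : Prop := {
  spec_cont : forall Om, measurable Om -> continuous (E Om);
  spec_sym : forall Om, measurable Om ->
    forall u v, dotp (E Om u) v = dotp u (E Om v);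
  spec_set0 : forall u, E set0 u = 0;
  spec_setT : forall u, E setT u = u;
  spec_setI : forall Om1 Om2, measurable Om1 -> measurable Om2 ->
    forall u, E Om1 (E Om2 u) = E (Om1 `&` Om2) u;
  spec_sigma_additive : forall A : (set C)^nat,
    (forall i, measurable (A i)) -> trivIset setT A ->
    forall u, (fun n => \sum_(i < n) E (A i) u) @ \oo -->
      E (\bigcup_i A i) u }.

(* [A = int z dE_z], with its natural domain. *)
Definition spectral_measure_of (A : oper H H) (E : set C -> {linear H -> H}) :=
  let EE := fun Om => everywhere (E Om) in
  [/\ spectral_measure E,
      odom A = [set f |
        (\int[measure_of (fun Om => (complex.Re (matrix_coeff EE f f Om))%:E)]_z
           ((modC (z : R[i])) ^+ 2)%:E < +oo)%E]
    & forall f g, odom A f ->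
        dotp (A f) g = cmeasure_integral (matrix_coeff EE f g) setT id].

Record resolution_of_identity (D : set H) (F : set C -> oper H H) : Prop := {
  res_dense : dense D;
  res_dom : forall Om, measurable Om -> odom (F Om) = D;
  res_linear : forall Om, measurable Om -> olinear (F Om);
  res_set0 : F set0 =op Oper D (fun=> 0);
  res_setT : F setT =op Oper D id;
  res_setI : forall Om1 Om2, measurable Om1 -> measurable Om2 ->
    ocomp (F Om1) (F Om2) =op F (Om1 `&` Om2) /\
    ocomp (F Om2) (F Om1) =op F (Om1 `&` Om2);
  res_sigma_additive : forall A : (set C)^nat,
    (forall i, measurable (A i)) -> trivIset setT A ->
    forall f, D f -> (fun n => \sum_(i < n) F (A i) f) @ \oo -->
      F (\bigcup_i A i) f }.

(* Requiring every [F Om] to be closed and different from its adjoint is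
   contradictory: if the restriction of 0 to a dense [D] is closed, then [D] is
   the whole space, and 0 is self-adjoint. *)
Definition strict_nsa_resolution (D : set H) (F : set C -> oper H H) :=
  resolution_of_identity D F /\
  forall Om, measurable Om ->
    closed_oper (F Om) /\ ~ (F Om =op adjoint (F Om)).

Lemma closed_zero_dom (D : set H) :
  dense D -> closed_oper (Oper D (fun=> 0 : H)) -> D = setT.
Proof.
move=> dD clD; apply/seteqP; split=> // x _.
have : closure (graph (Oper D (fun=> 0 : H))) (x, 0).
  move=> B [[B1 B2]] /= [nB1 nB2] sB.
  have [y [/= Dy By]] : D `&` B1 !=set0.
    have [U [oU Ux] sU] : exists2 U, (open U /\ U x) & U `<=` B1.
      by move: nB1; rewrite nbhsE /= => -[U [oU Ux] sU]; exists U.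
    have [y [Uy Dy]] := dD U (ex_intro _ x Ux) oU.
    by exists y; split => //; exact: sU.
  exists (y, 0); split; first by split.
  by apply: sB; split => //=; exact: nbhs_singleton.
by move/closure_id: clD => <- [].
Qed.

Lemma strict_nsa_resolution_contra (D : set H) (F : set C -> oper H H) :
  ~ strict_nsa_resolution D F.
Proof.
move=> [resF /(_ set0 measurable0) [clF nF]]; apply: nF.
have F0 := res_set0 resF.
have DT : D = setT.
  by apply: closed_zero_dom (res_dense resF) _; rewrite /closed_oper -F0.
have F0f f : F set0 f = 0.
  have : graph (Oper D (fun=> 0 : H)) (f, 0) by rewrite DT.
  by rewrite -F0 => -[_ /= <-].
have dotp0 (g : H) : dotp (0 : H) g = 0.
  by rewrite /dotp linear0l.
have adj0 g : adjoint_rel (F set0) g 0.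
  by move=> f _; rewrite F0f dotp0 /dotp linear0r.
have domF : odom (F set0) = setT by rewrite (res_dom resF measurable0).
rewrite /oeq /graph; apply/seteqP; split=> -[f h] /= [_ ->]; rewrite F0f.
  split; first by exists 0; exact: adj0.
  case: xgetP => // h' _ /(_ h'); rewrite domF F0f dotp0 /dotp hilbert_dotE.
  by move=> /(_ I)/esym/eqP; rewrite expf_eq0 /= normr_eq0 => /eqP.
rewrite domF; split => //.
case: xgetP => // h' _ /(_ h'); rewrite domF F0f dotp0 /dotp hilbert_dotE.
by move=> /(_ I)/esym/eqP; rewrite expf_eq0 /= normr_eq0 => /eqP.
Qed.

(* Closedness of [T] in the graph topology of [S], an operator with the same
   domain: if [x_n -> x] while [S x_n] and [T x_n] converge, then [x] is in the
   domain and [T x_n -> T x]. An everywhere defined [T] is moreover required to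
   be closed in the usual sense. *)
Definition closed_relative (V : normedModType R[i])
    (S : oper H V) (T : oper H H) :=
  closed [set p : H * (V * H) |
            [/\ odom T p.1, p.2.1 = S p.1 & p.2.2 = T p.1]] /\
  (odom T = setT -> closed_oper T).

(* The satisfiable form of [strict_nsa_resolution]: the operators are closed
   with respect to the graph topology that a closed operator [S] induces on its
   domain [D], and they are not self-adjoint unless [D] is the whole space. *)
Definition nsa_resolution (V : normedModType R[i]) (S : oper H V)
    (D : set H) (F : set C -> oper H H) :=
  [/\ closed_oper S, odom S = D, resolution_of_identity D F
    & forall Om, measurable Om ->
        closed_relative S (F Om) /\
        (D <> setT -> ~ (F Om =op adjoint (F Om)))].

End Resolutions.

(** * Scalars *)

Section Complexification.
Variable R : realType.

Definition complexification (V : realHilbert R) (VC : complexHilbert R)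
    (j : V -> VC) :=
  [/\ forall x y, j (x + y) = j x + j y,
      forall a x, j (a *: x) = (a%:C)%C *: j x,
      forall x y, dotp (j x) (j y) = (dotp x y)%:C%C
    & forall z, exists x y, z = j x + ('i)%C *: j y].

Definition complexified (V : realHilbert R) (VC : complexHilbert R)
    (j : V -> VC) (T : oper V V) (TC : oper VC VC) :=
  [/\ olinear TC,
      odom TC = [set z | exists x y,
        [/\ odom T x, odom T y & z = j x + ('i)%C *: j y]]
    & forall x, odom T x -> TC (j x) = j (T x)].

(* The data of a normal operator [A] on [Ht] and a bounded operator [L] with
   dense range from [Ht] to [H]. Complex measures and functions of [A] being
   involved, data on real Hilbert spaces are understood through their
   complexifications. *)
Inductive operator_data (Ht H : complexHilbert R) (A : oper Ht Ht)
    (L : {linear Ht -> H}) : Prop :=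
| ComplexData of
    separable_space Ht & separable_space H & normal_oper A &
    continuous L & dense (range L)
| RealData (Vt V : realHilbert R) (jt : Vt -> Ht) (j : V -> H)
    (Ar : oper Vt Vt) (Lr : {linear Vt -> V}) of
    complexification jt & complexification j &
    separable_space Vt & separable_space V & normal_oper Ar &
    continuous Lr & dense (range Lr) &
    complexified jt Ar A & (forall x, L (jt x) = j (Lr x)).

End Complexification.

Definition nsa_family (R : realType) (Ht H : complexHilbert R)
    (E : set (Cborel R) -> {linear Ht -> Ht}) (L : {linear Ht -> H}) :
    set (Cborel R) -> oper H H :=
  fun Om => ocomp (everywhere L) (ocomp (everywhere (E Om)) (pseudo_inverse L)).

(* Main.v *)
Require Import Defs.
From HB Require Import structures.
From mathcomp Require Import all_boot all_order all_algebra.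
From mathcomp Require Import sesquilinear complex.
From mathcomp Require Import all_classical all_reals all_analysis.
From mathcomp Require Import measurable_realfun.
From mathcomp Require Import ring lra.

Set Implicit Arguments.
Unset Strict Implicit.
Unset Printing Implicit Defensive.

Import Order.TTheory GRing.Theory Num.Theory numFieldNormedType.Exports.

Local Open Scope classical_set_scope.
Local Open Scope ring_scope.

(** The operators [F Om = L (E Om) Ld] inherit the algebra of the projections
    [E Om] because all the vectors involved stay in the coimage of [L], the
    orthogonal complement of its kernel. This complement is the closure of the
    range of the adjoint ([coimageE]), so that properness says exactly that it
    is invariant under [E]; on it the composition [Ld L] is the identity, and
    the inner factors of a product such as [L (E Om1) Ld L (E Om2) Ld] cancel
    ([nsa_familyM]). The same cancellation gives the multiplicativity of the
    integrals ([nsa_integralM]), once the functional calculus of [E] is known to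
    be multiplicative and to preserve the coimage.

    Since [dotp (F Om f) g = dotp (E Om (Ld f)) (Ls g)], all the measures in
    question are coefficients of [E]. Such a coefficient is countably additive,
    and its variation is at most [nr u * nr v] by orthogonality of the ranges of
    [E] on disjoint sets ([variation_coef_le]). The operator [m(A)] comes from
    the Riesz theorem applied to the integrals of [m] against the coefficients,
    and its algebraic properties extend from indicator functions to bounded
    measurable functions by [bounded_functional_ext], since simple functions are
    uniformly dense. The spectrum is closed, hence measurable, so that these
    arguments apply to functions on it.

    For the identity between total variations, the coefficient of [m(A) u] has
    density [m] with respect to the coefficient of [u]. The variation of a
    complex measure is a measure ([cmeasure_tvE]), and cutting the domain into
    finitely many pieces on which [m] is almost constant shows that passing to
    total variations turns the density [m] into its modulus
    ([integral_modC_tv]).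

    Closedness relative to [Ld] holds because the graph is described by closed
    conditions on [u = Ld f] ([sandwich_closed]). If [L] is onto, [Ld] is
    moreover bounded, by uniform boundedness applied to the adjoint
    ([pseudo_inverse_bounded]). Finally, a self-adjoint idempotent is everywhere
    defined ([selfadjoint_idempotent_everywhere]), so that no [F Om] is
    self-adjoint when the range of [L] is not the whole space. *)

(** * Real-valued norms *)

Lemma normcR (R : realType) (x : R) : `|(x%:C)%C : R[i]| = (`|x|%:C)%C.
Proof. by rewrite normc_def /= expr0n addr0 sqrtr_sqr. Qed.

(** Norms on a complex normed module take values in [R[i]]; their real parts
    are available for infima, limits and linear arithmetic in [R]. *)
Definition nr (R : realType) (V : normedModType R[i]) (v : V) : R :=
  complex.Re `|v|.

Section RealNorm.
Variables (R : realType).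
Implicit Types V : normedModType R[i].

Lemma normr_nr V (v : V) : `|v| = ((nr v)%:C)%C.
Proof. by rewrite /nr RRe_real// normr_real. Qed.

Lemma normc_modC (z : R[i]) : `|z| = ((modC z)%:C)%C.
Proof. by rewrite /modC RRe_real// normr_real. Qed.

Lemma nr_ge0 V (v : V) : 0 <= nr v.
Proof. by rewrite -lecR -normr_nr normr_ge0. Qed.

Lemma nr0 V : nr (0 : V) = 0.
Proof. by rewrite /nr normr0. Qed.

Lemma nr_eq0 V (v : V) : nr v = 0 -> v = 0.
Proof. by move=> v0; apply/normr0_eq0; rewrite normr_nr v0. Qed.

Lemma nrN V (v : V) : nr (- v) = nr v.
Proof. by rewrite /nr normrN. Qed.

Lemma nr_distC V (u v : V) : nr (u - v) = nr (v - u).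
Proof. by rewrite -nrN opprB. Qed.

Lemma nrD V (u v : V) : nr (u + v) <= nr u + nr v.
Proof. by rewrite -lecR rmorphD/= -!normr_nr ler_normD. Qed.

Lemma nr_distD V (w u v : V) : nr (u - v) <= nr (u - w) + nr (w - v).
Proof. by rewrite (le_trans _ (nrD _ _))// addrA subrK. Qed.

Lemma nrZ V (a : R[i]) (v : V) : nr (a *: v) = modC a * nr v.
Proof.
by apply: (@complexI R); rewrite rmorphM/= -!normr_nr normrZ normc_modC.
Qed.

Lemma modC_ge0 (z : R[i]) : 0 <= modC z.
Proof. exact: (@nr_ge0 R[i]^o). Qed.

Lemma modCD (u v : R[i]) : modC (u + v) <= modC u + modC v.
Proof. exact: (@nrD R[i]^o). Qed.

Lemma modCM (u v : R[i]) : modC (u * v) = modC u * modC v.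
Proof. exact: (@nrZ R[i]^o). Qed.

Lemma modC_eq0 (z : R[i]) : modC z = 0 -> z = 0.
Proof. exact: (@nr_eq0 R[i]^o). Qed.

Lemma modCR (x : R) : modC (x%:C)%C = `|x|.
Proof. by rewrite /modC normcR. Qed.

Lemma modC_conj (z : R[i]) : modC (Num.conj z) = modC z.
Proof. by rewrite /modC norm_conjC. Qed.

Lemma modC_Re (z : R[i]) : `|complex.Re z| <= modC z.
Proof. by rewrite -lecR -normc_modC normc_ge_Re. Qed.

Lemma modC_Im (z : R[i]) : `|complex.Im z| <= modC z.
Proof.
rewrite /modC normc_def /= -[leLHS]sqrtr_sqr ler_sqrt ?addr_ge0 ?sqr_ge0//.
by rewrite lerDr sqr_ge0.
Qed.

Lemma modC_ReIm (z : R[i]) :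
  modC z <= `|complex.Re z| + `|complex.Im z|.
Proof.
case: z => a b; have -> : (a +i* b)%C = (a%:C)%C + 'i%C * (b%:C)%C :> R[i].
  by rewrite [LHS]complexE.
rewrite (le_trans (modCD _ _))// modCR modCM modCR /=.
have -> : modC 'i%C = 1 :> R.
  by rewrite /modC normc_def /= expr0n expr1n add0r sqrtr1.
by rewrite mul1r !mul0r !mulr0 mul1r subrr addr0 !add0r.
Qed.

Lemma cvg_nrP V (T : Type) (F : set_system T) {FF : Filter F} (f : T -> V) l :
  f @ F --> l <->
  forall e : R, 0 < e -> \forall t \near F, nr (l - f t) < e.
Proof.
split=> [/cvgrPdist_lt fl e e0|fl].
  have := fl (e%:C)%C; rewrite ltcR => /(_ e0).
  by apply: filterS => t; rewrite normr_nr ltcR.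
apply/cvgrPdist_lt => -[e i]; rewrite ltcE /= => /andP[/eqP -> e0].
by apply: filterS (fl e e0) => t; rewrite normr_nr -ltcR.
Qed.

Lemma cvg_nr_bound V (u : nat -> V) l (b : nat -> R) :
  b @ \oo --> (0 : R) -> (forall n, nr (l - u n) <= b n) -> u @ \oo --> l.
Proof.
move=> /cvgrPdist_lt b0 ub; apply/cvg_nrP => e /b0.
apply: filterS => n; rewrite sub0r normrN; apply: le_lt_trans.
exact: le_trans (ub n) (ler_norm _).
Qed.

Lemma cvg_nr V (T : Type) (F : set_system T) {FF : Filter F} (f : T -> V) l :
  f @ F --> l -> (fun t => nr (f t)) @ F --> nr l.
Proof.
move=> /cvg_nrP fl; apply/cvgrPdist_lt => e e0; apply: filterS (fl _ e0) => t.
apply: le_lt_trans; rewrite ler_distlC.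
have := nr_distD 0 (f t) l; have := nrD (l - f t) (f t).
have := nrD (f t - l) l.
rewrite !subrK (nr_distC (f t)) => h1 h2 _; apply/andP; split; lra.
Qed.

Lemma nbhs_nrP V (x : V) (A : set V) :
  nbhs x A <-> exists2 e : R, 0 < e & forall y, nr (x - y) < e -> A y.
Proof.
split=> [/nbhs_normP[[e i]] /=|[e e0 eA]].
  rewrite ltcE /= => /andP[/eqP -> e0] eA; exists e => // y xy.
  by apply: eA; rewrite /= normr_nr ltcR.
by apply/nbhs_normP; exists (e%:C)%C; rewrite /= ?ltcR// => y /=;
  rewrite normr_nr ltcR; exact: eA.
Qed.

Lemma closure_nrP V (A : set V) x :
  closure A x <-> forall e : R, 0 < e -> exists2 y, A y & nr (x - y) < e.
Proof.
split=> [clA e e0|clA B /nbhs_nrP[e e0 eB]].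
  have /clA[y [Ay xy]] : nbhs x [set y | nr (x - y) < e].
    by apply/nbhs_nrP; exists e.
  by exists y.
by have [y Ay /eB By] := clA e e0; exists y.
Qed.

Lemma dense_nrP V (A : set V) :
  dense A <-> forall x (e : R), 0 < e -> exists2 y, A y & nr (x - y) < e.
Proof.
split=> [dA x e e0|dA O [x Ox] oO].
  have /nbhs_singleton xe : nbhs x [set y | nr (x - y) < e].
    by apply/nbhs_nrP; exists e.
  have : nbhs x [set y | nr (x - y) < e] by apply/nbhs_nrP; exists e.
  rewrite nbhsE => -[U [oU Ux] sU].
  by have [y [/sU xy Ay]] := dA U (ex_intro _ x Ux) oU; exists y.
have /nbhs_nrP[e e0 eO] : nbhs x O by exact: open_nbhs_nbhs.
by have [y Ay /eO Oy] := dA x e e0; exists y.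
Qed.

Lemma cauchy_nr (V : completeNormedModType R[i]) (u : nat -> V) :
  (forall e : R, 0 < e -> exists N, forall n m, (N <= n)%N -> (N <= m)%N ->
     nr (u n - u m) < e) -> exists l : V, u @ \oo --> l.
Proof.
move=> cu; have : cvg (u @ \oo).
  suff : cauchy (u @ \oo) by exact: cauchy_cvg.
  suff : cauchy_ex (u @ \oo) by exact: cauchy_exP.
  move=> -[e i]; rewrite ltcE /= => /andP[/eqP -> e0].
  have [N uN] := cu e e0; rewrite /fmapE -ball_normE; exists (u N), N => // n /= Nn.
  by rewrite normr_nr ltcR; exact: uN.
by move/cvg_ex.
Qed.

Lemma cauchy_nr_bound (V : completeNormedModType R[i]) (u : nat -> V)
    (b : nat -> R) : b @ \oo --> (0 : R) ->
  (forall n m, (n <= m)%N -> nr (u n - u m) <= b n) -> exists l : V, u @ \oo --> l.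
Proof.
move=> /cvgrPdist_lt b0 ub; apply: cauchy_nr => e e0.
have [N _ bN] := b0 _ e0; exists N => n m Nn Nm.
wlog nm : n m Nn Nm / (n <= m)%N.
  by move=> wl; case: (leqP n m) => [|/ltnW] nm; [|rewrite nr_distC]; exact: wl.
apply: le_lt_trans (ub _ _ nm) _; have := bN n Nn.
by rewrite /= sub0r normrN; apply: le_lt_trans; exact: ler_norm.
Qed.

Lemma linear_bounded (V W : normedModType R[i]) (f : {linear V -> W}) :
  continuous f -> exists2 M : R, 0 < M & forall x, nr (f x) <= M * nr x.
Proof.
move=> cf; have /nbhs_nrP[e e0 fe] : nbhs (0 : V) (f @^-1` [set y | nr y < 1]).
  apply: (cf 0); rewrite linear0; apply/nbhs_nrP; exists 1 => // y.
  by rewrite sub0r nrN.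
have e20 : 0 < e / 2 by rewrite divr_gt0.
exists (e / 2)^-1; first by rewrite invr_gt0.
move=> x; have [x0|x0] := eqVneq (nr x) 0.
  by rewrite (nr_eq0 x0) linear0 !nr0 mulr0.
have nx : 0 < nr x by rewrite lt_neqAle eq_sym x0 nr_ge0.
have := fe ((((e / 2) / nr x)%:C)%C *: x).
rewrite sub0r nrN /= linearZ /= !nrZ modCR ger0_norm; last first.
  by rewrite divr_ge0 ?nr_ge0// ltW.
rewrite divfK// => /(_ _)/ltW; rewrite mulrAC ler_pdivrMr// mul1r.
move=> h; rewrite ler_pdivlMl//; apply: h.
by rewrite ltr_pdivrMr// mulr_natr mulr2n ltrDl.
Qed.

Lemma bounded_linear (V W : normedModType R[i]) (f : {linear V -> W}) (M : R) :
  (forall x, nr (f x) <= M * nr x) -> continuous f.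
Proof.
move=> fM x; apply/cvg_nrP => e e0.
near=> y; rewrite -linearB (le_lt_trans (fM _))//.
have M1 : 0 < `|M| + 1 by rewrite ltr_pwDr.
apply: (@le_lt_trans _ _ ((`|M| + 1) * nr (x - y))).
  by rewrite ler_wpM2r ?nr_ge0// (le_trans (ler_norm _))// lerDl.
rewrite -ltr_pdivlMl//; near: y; apply/nbhs_nrP.
by exists ((`|M| + 1)^-1 * e) => //; rewrite mulr_gt0 ?invr_gt0.
Unshelve. all: by end_near. Qed.

Lemma closed_zeros (T : topologicalType) V (f : T -> V) :
  continuous f -> closed [set x | f x = 0].
Proof.
move=> cf; apply: (@preimage_closed _ _ f [set 0]) => [x _|]; first exact: cf.
apply: accessible_closed_set1; apply: hausdorff_accessible.
exact: norm_hausdorff.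
Qed.

End RealNorm.

(** * Orthogonal projection and uniform boundedness *)

Lemma conj_real (R : realType) (x : R) :
  Num.conj (x%:C)%C = (x%:C)%C :> R[i].
Proof. by apply: conj_Creal; apply/complex_realP; exists x. Qed.

Lemma conjcM (R : realType) (a b : R[i]) :
  Num.conj (a * b) = Num.conj a * Num.conj b.
Proof. exact: rmorphM. Qed.

Lemma conjcD (R : realType) (a b : R[i]) :
  Num.conj (a + b) = Num.conj a + Num.conj b.
Proof. exact: rmorphD. Qed.

Lemma conj_scale_self (R : realType) (r : R) (c : R[i]) :
  Num.conj ((r%:C)%C * c) * c = ((r * modC c ^+ 2)%:C)%C.
Proof.
rewrite conjcM conj_real -mulrA [Num.conj c * c]mulrC -normCK normc_modC.
by rewrite -rmorphXn -rmorphM.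
Qed.

Section Inner.
Variables (R : realType) (V : complexHilbert R).
Implicit Types u v w : V.

Lemma dotC u v : dotp u v = Num.conj (dotp v u).
Proof. by rewrite /dotp (hermC (hilbert_dot V)) expr0 mul1r. Qed.

Lemma dotDl u v w : dotp (u + v) w = dotp u w + dotp v w.
Proof. by rewrite /dotp linearDl. Qed.

Lemma dotZl a u v : dotp (a *: u) v = a * dotp u v.
Proof. by rewrite /dotp linearZl_LR. Qed.

Lemma dotNl u v : dotp (- u) v = - dotp u v.
Proof. by rewrite /dotp linearNl. Qed.

Lemma dotBl u v w : dotp (u - v) w = dotp u w - dotp v w.
Proof. by rewrite dotDl dotNl. Qed.

Lemma dot0l u : dotp 0 u = 0.
Proof. by rewrite /dotp linear0l. Qed.

Lemma dotDr u v w : dotp u (v + w) = dotp u v + dotp u w.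
Proof. by rewrite /dotp linearDr. Qed.

Lemma dotZr a u v : dotp u (a *: v) = Num.conj a * dotp u v.
Proof. by rewrite /dotp linearZr_LR. Qed.

Lemma dotNr u v : dotp u (- v) = - dotp u v.
Proof. by rewrite /dotp linearNr. Qed.

Lemma dotBr u v w : dotp u (v - w) = dotp u v - dotp u w.
Proof. by rewrite dotDr dotNr. Qed.

Lemma dot0r u : dotp u 0 = 0.
Proof. by rewrite /dotp linear0r. Qed.

Lemma dot_suml (I : Type) (r : seq I) (P : pred I) (F : I -> V) u :
  dotp (\sum_(i <- r | P i) F i) u = \sum_(i <- r | P i) dotp (F i) u.
Proof. by rewrite /dotp linear_sumlz. Qed.

Lemma dot_nr u : dotp u u = ((nr u ^+ 2)%:C)%C.
Proof. by rewrite /dotp hilbert_dotE normr_nr rmorphXn. Qed.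

Lemma dotxx_eq0 u : dotp u u = 0 -> u = 0.
Proof.
rewrite dot_nr => -[/eqP]; rewrite expf_eq0 /= => /eqP; exact: nr_eq0.
Qed.

Lemma dot_inj u v : (forall w, dotp u w = dotp v w) -> u = v.
Proof.
move=> uv; apply/eqP; rewrite -subr_eq0; apply/eqP/dotxx_eq0.
by rewrite dotBl uv subrr.
Qed.

Lemma nr_sqrB u v :
  nr (u - v) ^+ 2 = nr u ^+ 2 + nr v ^+ 2 - 2 * complex.Re (dotp u v).
Proof.
have := congr1 (@complex.Re R) (dot_nr (u - v)).
rewrite /= => <-; rewrite dotBl !dotBr !dot_nr (dotC v u).
by case: (dotp u v) => a b /=; ring.
Qed.

Lemma nr_sqrD u v :
  nr (u + v) ^+ 2 = nr u ^+ 2 + nr v ^+ 2 + 2 * complex.Re (dotp u v).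
Proof. by 
rewrite -{1}(opprK v) nr_sqrB nrN dotNr; case: (dotp u v) => a b /=; ring.
Qed.

(** This is the squared distance from [u] to the line spanned by [v]: that it
    is nonnegative is the Cauchy-Schwarz inequality, and that it is at least
    the distance to a subspace gives orthogonality in [projection]. *)
Lemma nr_sqr_line u v : v != 0 ->
  exists a : R[i], nr (u - a *: v) ^+ 2 =
    nr u ^+ 2 - modC (dotp u v) ^+ 2 / nr v ^+ 2.
Proof.
move=> v0; have nv : nr v != 0 by apply: contra_neq v0; exact: nr_eq0.
set c := dotp u v; exists (((nr v ^+ 2)^-1%:C)%C * c).
rewrite nr_sqrB dotZr nrZ modCM modCR ger0_norm ?invr_ge0 ?sqr_ge0//.
by rewrite conj_scale_self /=; field.
Qed.

Lemma CS u v : modC (dotp u v) <= nr u * nr v.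
Proof.
have [->|v0] := eqVneq v 0; first by rewrite dot0r nr0 mulr0 modCR normr0.
have nv : 0 < nr v.
  by rewrite lt_neqAle nr_ge0 andbT eq_sym; apply: contra_neq v0; exact: nr_eq0.
have [a ha] := nr_sqr_line u v0.
have : 0 <= nr u ^+ 2 - modC (dotp u v) ^+ 2 / nr v ^+ 2 by rewrite -ha sqr_ge0.
rewrite subr_ge0 ler_pdivrMr ?exprn_gt0// -exprMn.
by rewrite ler_sqr ?nnegrE ?modC_ge0 ?mulr_ge0 ?nr_ge0.
Qed.

Lemma dot_cvgl (T : Type) (F : set_system T) {FF : Filter F} (f : T -> V) l v :
  f @ F --> l -> (fun t => dotp (f t) v : R[i]^o) @ F --> (dotp l v : R[i]^o).
Proof.
move=> /cvg_nrP fl; apply/cvg_nrP => e e0.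
have v1 : 0 < nr v + 1 by rewrite ltr_pwDr ?nr_ge0.
have := fl (e / (nr v + 1)); rewrite divr_gt0// => /(_ isT).
apply: filterS => t; rewrite ltr_pdivlMr// -dotBl.
apply: le_lt_trans; apply: le_trans (CS _ _) _.
by rewrite ler_wpM2l ?nr_ge0// lerDl.
Qed.

Lemma nr_cvg_le (u : nat -> V) l w b N : u @ \oo --> l ->
  (forall n, (N <= n)%N -> nr (w - u n) <= b) -> nr (w - l) <= b.
Proof.
move=> /cvg_nrP ul ub; apply/ler_addgt0Pr => e e0.
have [M _ uM] := ul e e0.
have := uM (maxn N M) (leq_maxr _ _); have := ub _ (leq_maxl N M).
set n := maxn N M; move=> h1 h2; have := nr_distD (u n) w l.
by move=> h; apply: (le_trans h); rewrite lerD// nr_distC ltW.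
Qed.

Definition subspace (S : set V) :=
  S 0 /\ forall a u v, S u -> S v -> S (a *: u + v).

(** A minimizing sequence for the distance from [x] to [S] is Cauchy by the
    parallelogram identity, and minimality makes the difference orthogonal. *)
Lemma projection (S : set V) x : closed S -> subspace S ->
  exists2 p, S p & forall s, S s -> dotp (x - p) s = 0.
Proof.
move=> clS [S0 Slin].
pose D := [set nr (x - s) ^+ 2 | s in S].
have infD : has_inf D.
  split; first by exists (nr (x - 0) ^+ 2), 0.
  by exists 0 => _ [s _ <-]; exact: sqr_ge0.
have Dge s : S s -> inf D <= nr (x - s) ^+ 2.
  by move=> Ss; apply: ge_inf; [exact: infD.2|exists s].
have /choice[s_ s_P] (n : nat) : exists s,
    S s /\ nr (x - s) ^+ 2 < inf D + n.+1%:R^-1.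
  have n0 : 0 < n.+1%:R^-1 :> R by rewrite invr_gt0.
  by have [_ [s Ss <-] hs] := inf_adherent n0 infD; exists s.
have SD u v : S u -> S v -> S (u + v).
  by move=> Su Sv; rewrite -(scale1r u); exact: Slin.
have SZ a u : S u -> S (a *: u).
  by move=> Su; rewrite -(addr0 (a *: u)); exact: Slin.
have cs n m : (n <= m)%N -> nr (s_ n - s_ m) ^+ 2 <= 4 / n.+1%:R.
  move=> nm; have [Sn hn] := s_P n; have [Sm hm] := s_P m.
  have -> : s_ n - s_ m = (x - s_ m) - (x - s_ n) by rewrite opprB [RHS]addrC subrKA.
  have mid : (x - s_ m) + (x - s_ n) = 2 *: (x - 2^-1 *: (s_ m + s_ n)).
    rewrite scalerBr scalerA divff ?scale1r ?pnatr_eq0//.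
    by rewrite scaler_nat mulr2n addrACA opprD.
  have h4 : nr ((x - s_ m) + (x - s_ n)) ^+ 2 >= 4 * inf D.
    rewrite mid nrZ exprMn.
    have -> : modC (2 : R[i]) ^+ 2 = 4.
      have -> : (2 : R[i]) = (2%:C)%C by rewrite rmorph_nat.
      by rewrite modCR ger0_norm// expr2; ring.
    by rewrite ler_wpM2l//; apply: Dge; apply: SZ; exact: SD.
  rewrite nr_sqrD in h4; rewrite nr_sqrB.
  have h1 : m.+1%:R^-1 <= n.+1%:R^-1 :> R.
    by rewrite lef_pV2 ?posrE// ler_nat.
  move: h4 hn hm h1.
  move: (nr _ ^+ 2) (nr _ ^+ 2) (complex.Re _) (inf D) (n.+1%:R^-1) (m.+1%:R^-1).
  by move=> a b c d k l; lra.
have [p sp] : exists p : V, s_ @ \oo --> p.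
  apply: cauchy_nr => e e0.
  have e2 : 0 < e ^+ 2 by rewrite exprn_gt0.
  have hN n : (Num.truncn (4 / e ^+ 2) <= n)%N -> 4 / n.+1%:R < e ^+ 2.
    move=> Nn; rewrite ltr_pdivrMr// mulrC -ltr_pdivrMr//.
    by rewrite (lt_le_trans (truncnS_gt _))// ler_nat ltnS.
  exists (Num.truncn (4 / e ^+ 2)) => n m Nn Nm.
  have hsq k l : (Num.truncn (4 / e ^+ 2) <= k)%N -> (k <= l)%N ->
      nr (s_ k - s_ l) < e.
    move=> Nk kl; rewrite -ltr_sqr ?nnegrE ?nr_ge0 ?ltW//.
    by rewrite (le_lt_trans (cs _ _ kl))// hN.
  case: (leqP n m) => [|/ltnW] nm; first exact: hsq.
  by rewrite nr_distC; exact: hsq.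
exists p.
  by apply: (@closed_cvg _ _ _ _ s_ S clS _ p sp); apply: nearW => n; case: (s_P n).
move=> s Ss; have [->|s0] := eqVneq s 0; first by rewrite dot0r.
have ns : nr s != 0 by apply: contra_neq s0; exact: nr_eq0.
have bnd n : modC (dotp (x - s_ n) s) ^+ 2 <= nr s ^+ 2 * n.+1%:R^-1.
  have [a ha] := nr_sqr_line (x - s_ n) s0.
  have [Sn hn] := s_P n.
  have := Dge (a *: s + s_ n) (Slin _ _ _ Ss Sn).
  rewrite (_ : x - (a *: s + s_ n) = x - s_ n - a *: s); last first.
    by rewrite opprD addrAC addrA addrAC.
  rewrite ha => hD.
  have : modC (dotp (x - s_ n) s) ^+ 2 / nr s ^+ 2 <= n.+1%:R^-1.
    move: hn hD; move: (nr _ ^+ 2) (inf D) (n.+1%:R^-1) (_ / _).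
    by move=> a' b' c' d'; lra.
  by rewrite ler_pdivrMr 1?mulrC// exprn_gt0// lt_neqAle eq_sym ns nr_ge0.
have c1 : (fun n => modC (dotp (x - s_ n) s) ^+ 2) @ \oo
    --> modC (dotp (x - p) s) ^+ 2.
  have : (fun n => (dotp (x - s_ n) s : R[i]^o)) @ \oo
      --> (dotp (x - p) s : R[i]^o).
    by apply: dot_cvgl; apply: cvgB sp; exact: cvg_cst.
  by move=> /cvg_nr h; apply: cvgM; exact: h.
have c2 : (fun n => nr s ^+ 2 * n.+1%:R^-1) @ \oo --> nr s ^+ 2 * 0.
  by apply: cvgM; [exact: cvg_cst|exact: cvg_harmonic].
have := ler_cvg_to c1 c2 (nearW _ bnd); rewrite mulr0 => h0.
apply: modC_eq0; apply/eqP; rewrite -sqrf_eq0.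
by rewrite eq_le h0 sqr_ge0.
Qed.

Lemma subspace_closure (S : set V) : subspace S -> subspace (closure S).
Proof.
move=> [S0 Slin]; split; first exact: subset_closure.
move=> a u v /closure_nrP cu /closure_nrP cv; apply/closure_nrP => e e0.
have a1 : 0 < modC a + 1 by rewrite ltr_pwDr ?modC_ge0.
have e20 : 0 < e / 2 by rewrite divr_gt0.
have [u' Su' uu'] := cu (e / 2 / (modC a + 1)) (divr_gt0 e20 a1).
have [v' Sv' vv'] := cv (e / 2) e20.
exists (a *: u' + v'); first exact: Slin.
rewrite opprD addrACA -scalerBr (le_lt_trans (nrD _ _))// nrZ.
rewrite [ltRHS](splitr e) ler_ltD//.
rewrite (@le_trans _ _ ((modC a + 1) * nr (u - u')))//.
  by rewrite ler_wpM2r ?nr_ge0// lerDl.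
by rewrite mulrC -ler_pdivlMr// ltW.
Qed.

(** A nonzero functional is the inner product with a multiple of a vector
    orthogonal to its kernel. *)
Lemma riesz (phi : V -> R[i]) (M : R) :
  (forall a u v, phi (a *: u + v) = a * phi u + phi v) ->
  (forall u, modC (phi u) <= M * nr u) ->
  exists h, forall u, phi u = dotp u h.
Proof.
move=> plin pM.
have p0 : phi 0 = 0.
  apply: modC_eq0; apply/eqP; rewrite eq_le modC_ge0 andbT.
  by rewrite (le_trans (pM 0))// nr0 mulr0.
have pZ a u : phi (a *: u) = a * phi u by rewrite -[X in phi X]addr0 plin p0 addr0.
have pB u v : phi (u - v) = phi u - phi v.
  by rewrite addrC -scaleN1r plin mulN1r addrC.
have [[x x0]|px] := pselect (exists x, phi x != 0); last first.
  exists 0 => u; rewrite dot0r; apply/eqP/negP => /negP u0; apply: px.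
  by exists u.
pose S := [set u | phi u = 0].
have clS : closed S.
  move=> y /closure_nrP cy; rewrite /S /=; apply: modC_eq0; apply/eqP.
  rewrite eq_le modC_ge0 andbT; apply/ler_addgt0Pr => e e0; rewrite add0r.
  have M1 : 0 < `|M| + 1 by rewrite ltr_pwDr.
  have [z Sz yz] := cy (e / (`|M| + 1)) (divr_gt0 e0 M1).
  have -> : phi y = phi (y - z) by rewrite pB Sz subr0.
  rewrite (le_trans (pM _))// (@le_trans _ _ ((`|M| + 1) * nr (y - z)))//.
    by rewrite ler_wpM2r ?nr_ge0// (le_trans (ler_norm _))// lerDl.
  by rewrite mulrC -ler_pdivlMr// ltW.
have sS : subspace S.
  by split=> // a u v; rewrite /S /= => u0 v0; rewrite plin u0 v0 mulr0 addr0.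
have [p Sp orth] := projection x clS sS.
set e := x - p.
have pe : phi e = phi x by rewrite pB Sp subr0.
have e0 : dotp e e != 0.
  apply/negP => /eqP/dotxx_eq0 e0; move: x0; rewrite -pe e0 p0 eqxx.
  by [].
exists (Num.conj (phi e / dotp e e) *: e) => u; rewrite dotZr conjCK.
have : dotp e (u - (phi u / phi e) *: e) = 0.
  apply: orth; rewrite /S /= pB pZ divfK ?subrr// pe.
  by [].
rewrite dotBr dotZr => /eqP; rewrite subr_eq0 => /eqP h.
rewrite [dotp u e]dotC h (conjcM (Num.conj _)) conjCK -dotC.
by rewrite -pe in x0; field; rewrite e0 x0.
Qed.

(** Gliding hump: against a vector of norm above [3 ^+ n * n.+1], a move of
    length [3 ^- n] of the current point produces an inner product of modulus
    above [n.+1], and all the later moves destroy at most half of it. *)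
Lemma uniform_boundedness (G : set V) :
  (forall f, exists M : R, forall g, G g -> modC (dotp f g) <= M) ->
  exists M : R, forall g, G g -> nr g <= M.
Proof.
move=> pb; apply: contrapT => nb.
have /choice[g_ g_P] (n : nat) : exists g, G g /\ 3 ^+ n * n.+1%:R < nr g.
  apply: contrapT => ng; apply: nb; exists (3 ^+ n * n.+1%:R) => g Gg.
  by rewrite leNgt; apply/negP => h; apply: ng; exists g.
have ng n : 0 < nr (g_ n).
  by apply: le_lt_trans (g_P n).2; rewrite mulr_ge0// exprn_ge0.
have t0 n : 0 < (3 ^- n : R) by rewrite invr_gt0 exprn_gt0.
have /choice[step stepP] (nx : nat * V) : exists y,
    nr (nx.2 - y) <= 3 ^- nx.1 /\
    3 ^- nx.1 * nr (g_ nx.1) <= modC (dotp y (g_ nx.1)).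
  case: nx => n x /=; set g := g_ n.
  pose e := ((3 ^- n / nr g)%:C)%C *: g.
  have ne : nr e = 3 ^- n.
    rewrite nrZ modCR ger0_norm; first by rewrite divfK// (gt_eqF (ng n)).
    by rewrite divr_ge0 ?nr_ge0// (ltW (t0 n)).
  have de : dotp e g = ((3 ^- n * nr g)%:C)%C.
    rewrite dotZl dot_nr -rmorphM /=; congr ((_%:C)%C).
    have : nr g != 0 by rewrite (gt_eqF (ng n)).
    by move: (3 ^- n) => t ?; field.
  (* The values at [x + e] and [x - e] differ by [2 * 3 ^- n * nr g]. *)
  have [h|h] := leP (3 ^- n * nr g) (modC (dotp (x + e) g)).
    by exists (x + e); rewrite opprD addrA subrr sub0r nrN ne.
  exists (x - e); rewrite opprB addrC subrK ne; split=> //.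
  have := modCD (dotp (x + e) g) (- dotp (x - e) g).
  have -> : modC (- dotp (x - e) g) = modC (dotp (x - e) g).
    by rewrite /modC normrN.
  rewrite -dotBl opprB [x + e + _]addrC subrKA (dotDl e e) de -rmorphD modCR.
  rewrite ger0_norm; last by rewrite addr_ge0// mulr_ge0 ?nr_ge0 ?ltW.
  by move: h; move: (3 ^- n * nr g) (modC _) (modC _) => a b c; lra.
pose x_ := fix x_ n := if n is m.+1 then step (m, x_ m) else 0 : V.
have xS n : nr (x_ n - x_ n.+1) <= 3 ^- n by have [] := stepP (n, x_ n).
have xG n : 3 ^- n * nr (g_ n) <= modC (dotp (x_ n.+1) (g_ n)).
  by have [] := stepP (n, x_ n).
have xnm n k : nr (x_ n - x_ (n + k)%N) <= 3 / 2 * (3 ^- n - 3 ^- (n + k)).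
  elim: k => [|k ih]; first by rewrite addn0 !subrr nr0 mulr0.
  apply: le_trans (nr_distD (x_ (n + k)%N) _ _) _; rewrite addnS.
  have := xS (n + k)%N; move: ih; rewrite [3 ^- (n + k).+1](_ : _ = 3^-1 * 3 ^- (n + k)).
    move: (3 ^- n) (3 ^- (n + k)) (nr _) (nr _) => a b c d; lra.
  by rewrite exprS invfM.
have xle n m : (n <= m)%N -> nr (x_ n - x_ m) <= 3 / 2 * 3 ^- n.
  move=> nm; rewrite -(subnKC nm) (le_trans (xnm _ _))//.
  by rewrite ler_wpM2l// lerBlDr lerDl ltW.
have [x xx] : exists x : V, x_ @ \oo --> x.
  apply: (@cauchy_nr_bound _ _ _ (fun n => 3 / 2 * 3 ^- n)); last exact: xle.
  rewrite -[X in _ --> X](mulr0 (3 / 2)); apply: cvgM; first exact: cvg_cst.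
  under eq_fun do rewrite -exprVn.
  apply: cvg_expr; rewrite ger0_norm// invf_lt1// ltr1n //.
have [M xM] := pb x.
pose n := Num.truncn (2 * M).
have : modC (dotp x (g_ n)) <= M by apply: xM; exact: (g_P n).1.
have hx : nr (x_ n.+1 - x) <= 3 / 2 * 3 ^- n.+1.
  by apply: (@nr_cvg_le x_ x _ _ n.+1) => // m; exact: xle.
have := modCD (dotp x (g_ n)) (dotp (x_ n.+1 - x) (g_ n)).
rewrite -dotDl addrC subrK => h1 h2.
have h3 := CS (x_ n.+1 - x) (g_ n).
have h4 : nr (x_ n.+1 - x) * nr (g_ n) <= 3 / 2 * 3 ^- n.+1 * nr (g_ n).
  by rewrite ler_wpM2r ?nr_ge0.
rewrite [3 ^- n.+1](_ : _ = 3^-1 * 3 ^- n) in h4; last by rewrite exprS invfM.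
have h5 := xG n.
have h6 : n.+1%:R < 3 ^- n * nr (g_ n).
  by rewrite ltr_pdivlMl ?exprn_gt0//; exact: (g_P n).2.
have h7 : 2 * M < n.+1%:R by exact: truncnS_gt.
move: h1 h2 h3 h4 h5 h6 h7; rewrite -!mulrA.
move: (3 ^- n * nr (g_ n)) (modC _) (modC _) (modC _) (nr _ * nr _) (n.+1%:R).
by move=> a b c d e f; lra.
Qed.

End Inner.

(** * Adjoint and pseudo-inverse of a bounded operator *)

Section BoundedOperator.
Variables (R : realType) (V W : complexHilbert R) (L : {linear V -> W}).
Hypothesis cL : continuous L.
Local Notation Ls := (adjoint (everywhere L)).
Local Notation Ld := (pseudo_inverse L).

Lemma adjointE f g : dotp (L f) g = dotp f (Ls g).
Proof.
have [M M0 LM] := linear_bounded cL.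
have [h hP] : exists h, forall u, dotp (L u) g = dotp u h.
  apply: (@riesz _ _ _ (M * nr g)) => [a u v|u].
    by rewrite linearP dotDl dotZl.
  by rewrite (le_trans (CS _ _))// mulrAC ler_wpM2r ?nr_ge0.
have : adjoint_rel (everywhere L) g (Ls g).
  by rewrite /adjoint /=; case: xgetP => [h' _ //|/(_ h)[]] => u _; exact: hP.
by apply.
Qed.

Lemma adjoint_linear a u v : Ls (a *: u + v) = a *: Ls u + Ls v.
Proof.
apply: dot_inj => w; rewrite dotDl dotZl !(dotC (Ls _) w) -!adjointE.
by rewrite dotDr dotZr conjcD conjcM conjCK.
Qed.

Lemma subspace_range_adjoint : subspace (range Ls).
Proof.
split.
  exists 0 => //; apply: dot_inj => w.
  by rewrite dotC -adjointE dot0r dot0l conjC0.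
move=> a _ _ [u _ <-] [v _ <-]; exists (a *: u + v) => //.
exact: adjoint_linear.
Qed.

(** On this orthogonal complement of the kernel, [L] is injective and has its
    full range; [pseudo_inverse L] is the inverse of that restriction. *)
Definition coimage : set V := [set h | forall k, L k = 0 -> dotp h k = 0].

Lemma closed_orthogonal (U : complexHilbert R) (K : set U) :
  closed [set h : U | forall k, K k -> dotp h k = 0].
Proof.
move=> h /closure_nrP hK k Kk; apply: modC_eq0; apply/eqP.
rewrite eq_le modC_ge0 andbT; apply/ler_addgt0Pr => e e0; rewrite add0r.
have k1 : 0 < nr k + 1 by rewrite ltr_pwDr ?nr_ge0.
have [y /(_ k Kk) yK hy] := hK (e / (nr k + 1)) (divr_gt0 e0 k1).
rewrite (_ : dotp h k = dotp (h - y) k); last by rewrite dotBl yK subr0.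
rewrite (le_trans (CS _ _))// (@le_trans _ _ (nr (h - y) * (nr k + 1)))//.
  by rewrite ler_wpM2l ?nr_ge0// lerDl.
by rewrite -ler_pdivlMr// ltW.
Qed.

Lemma closed_coimage : closed coimage.
Proof. exact: (@closed_orthogonal V [set k | L k = 0]). Qed.

Lemma subspace_orthogonal (U : complexHilbert R) (K : set U) :
  subspace [set h : U | forall k, K k -> dotp h k = 0].
Proof.
split=> [k _|a u v uK vK k Kk]; first by rewrite dot0l.
by rewrite dotDl dotZl uK// vK// mulr0 addr0.
Qed.

(** After projection on the closure of [range Ls], the remainder is orthogonal
    to [range Ls], hence in the kernel of [L]; for a vector of the coimage it
    is also orthogonal to that kernel. *)
Lemma coimageE : coimage = closure (range Ls).
Proof.
have sub g : coimage (Ls g).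
  by move=> k k0; rewrite dotC -adjointE k0 dot0l conjC0.
apply/seteqP; split=> [h hK|h hR].
  have [p pR hp] := projection h (@closed_closure _ (range Ls))
    (subspace_closure subspace_range_adjoint).
  have pK : coimage p.
    apply: closed_coimage; apply: closure_subset pR => _ [g _ <-]; exact: sub.
  have h0 : L (h - p) = 0.
    apply: dot_inj => g; rewrite adjointE dot0l; apply: hp.
    by apply: subset_closure; exists g.
  suff -> : h = p by [].
  apply/eqP; rewrite -subr_eq0; apply/eqP/dotxx_eq0.
  by rewrite dotBl hK// pK// subrr.
apply: closed_coimage; apply: closure_subset hR => _ [g _ <-]; exact: sub.
Qed.

Lemma coimage_decomposition x : exists2 p, coimage p & L p = L x.
Proof.
have clK : closed [set k | L k = 0].
  move=> x' /closure_nrP xK; rewrite /=; apply: nr_eq0; apply/eqP.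
  have [M M0 LM] := linear_bounded cL.
  rewrite eq_le nr_ge0 andbT; apply/ler_addgt0Pr => e e0; rewrite add0r.
  have [y /= yK xy] := xK (e / M) (divr_gt0 e0 M0).
  rewrite -[L x']subr0 -yK -linearB (le_trans (LM _))//.
  by rewrite mulrC -ler_pdivlMr// ltW.
have sK : subspace [set k | L k = 0].
  split=> /=; first exact: linear0.
  by move=> a u v; rewrite /= linearP => -> ->; rewrite scaler0 addr0.
have [p pK hp] := projection x clK sK.
by exists (x - p); [exact: hp|rewrite linearB pK subr0].
Qed.

Lemma coimage_inj u v : coimage u -> coimage v -> L u = L v -> u = v.
Proof.
move=> uK vK uv; apply/eqP; rewrite -subr_eq0; apply/eqP/dotxx_eq0.
have k0 : L (u - v) = 0 by rewrite linearB uv subrr.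
by rewrite dotBl uK// vK// subrr.
Qed.

Lemma pseudo_inverseP f : range L f -> L (Ld f) = f /\ coimage (Ld f).
Proof.
move=> [x _ <-]; have [p pK px] := coimage_decomposition x.
by rewrite /pseudo_inverse /=; case: xgetP => [h' _ //|/(_ p)[]].
Qed.

Lemma pseudo_inverseK h : coimage h -> Ld (L h) = h.
Proof.
move=> hK; have [h1 h2] := @pseudo_inverseP (L h) (ex_intro2 _ _ h I erefl).
exact: coimage_inj.
Qed.

Lemma graph_pseudo_inverse :
  graph Ld = [set p | L p.2 = p.1 /\ coimage p.2].
Proof.
apply/seteqP; split=> [[f h] [/= fL ->]|[f h] [/= <- hK]].
  exact: pseudo_inverseP.
by split; [exists h|rewrite pseudo_inverseK].
Qed.

Lemma subspace_range : subspace (range L).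
Proof.
split; first by exists 0 => //; rewrite linear0.
by move=> a _ _ [u _ <-] [v _ <-]; exists (a *: u + v) => //; rewrite linearP.
Qed.

Lemma subspace_coimage : subspace coimage.
Proof. exact: subspace_orthogonal. Qed.

Lemma pseudo_inverse_linear a u v : range L u -> range L v ->
  Ld (a *: u + v) = a *: Ld u + Ld v.
Proof.
move=> uL vL; have [u1 u2] := pseudo_inverseP uL.
have [v1 v2] := pseudo_inverseP vL.
rewrite -{1}u1 -{1}v1 -linearP pseudo_inverseK//.
exact: subspace_coimage.2.
Qed.

(** If [L] is onto then [Ls] is bounded below, by uniform boundedness applied
    to the vectors which [Ls] maps into the unit ball. *)
Lemma adjoint_bounded_below : range L = setT ->
  exists2 M : R, 0 < M & forall g, nr g <= M * nr (Ls g).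
Proof.
move=> LT; have [f|M GM] := @uniform_boundedness _ W [set g | nr (Ls g) <= 1].
  have [h _ <-] : range L f by rewrite LT.
  exists (nr h) => g /= g1; rewrite adjointE (le_trans (CS _ _))//.
  by rewrite ler_piMr ?nr_ge0.
exists (`|M| + 1) => [|g]; first by rewrite ltr_pwDr.
have M1 : M <= `|M| + 1 by rewrite (le_trans (ler_norm _))// lerDl.
have [g0|g0] := eqVneq (nr (Ls g)) 0.
  have -> : g = 0.
    apply: dotxx_eq0; have [h _ {1}<-] : range L g by rewrite LT.
    by rewrite adjointE (nr_eq0 g0) dot0r.
  by rewrite nr0 mulr_ge0 ?nr_ge0// addr_ge0.
have gp : 0 < nr (Ls g) by rewrite lt_neqAle eq_sym g0 nr_ge0.
pose c := ((nr (Ls g))^-1%:C)%C : R[i].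
have cE : modC c = (nr (Ls g))^-1 by rewrite modCR ger0_norm// invr_ge0 ltW.
have : nr (c *: g) <= M.
  suff : nr (Ls (c *: g)) <= 1 by exact: GM.
  have -> : Ls (c *: g) = c *: Ls g.
    apply: dot_inj => w.
    by rewrite dotC -adjointE dotZr adjointE conjcM conjCK dotZl -dotC.
  by rewrite nrZ cE mulVf.
rewrite nrZ cE mulrC ler_pdivrMr// => /le_trans; apply.
by rewrite ler_wpM2r ?nr_ge0.
Qed.

(** A vector [h = Ld f] is close to some [Ls g], so that [nr h ^+ 2] is close to
    [dotp f g], while [nr g] is controlled by [nr (Ls g)], hence by [nr h]. *)
Lemma pseudo_inverse_bounded : range L = setT ->
  exists2 M : R, 0 < M & forall f, nr (Ld f) <= M * nr f.
Proof.
move=> LT; have [M M0 LsM] := adjoint_bounded_below LT; exists M => // f.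
have [fL hK] : L (Ld f) = f /\ coimage (Ld f).
  by apply: pseudo_inverseP; rewrite LT.
set h := Ld f in fL hK *.
have [->|h0] := eqVneq h 0; first by rewrite nr0 mulr_ge0 ?nr_ge0// ltW.
have hp : 0 < nr h.
  by rewrite lt_neqAle nr_ge0 andbT eq_sym; apply: contra_neq h0; exact: nr_eq0.
suff : nr h ^+ 2 <= M * nr f * nr h by rewrite expr2 ler_pM2r.
apply/ler_addgt0Pr => e e0.
have K0 : 0 < nr h + M * nr f.
  by rewrite ltr_pwDl// mulr_ge0 ?nr_ge0// ltW.
move: hK; rewrite coimageE => /closure_nrP/(_ (e / (nr h + M * nr f))).
rewrite divr_gt0// => /(_ isT)[_ [g _ <-]]; rewrite ltr_pdivlMr// => hg.
have h1 : nr h ^+ 2 <= nr h * nr (h - Ls g) + nr f * nr g.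
  have -> : nr h ^+ 2 = modC (dotp h (h - Ls g) + dotp f g).
    by rewrite -fL adjointE -dotDr subrK dot_nr modCR ger0_norm ?sqr_ge0.
  by rewrite (le_trans (modCD _ _))// lerD// CS.
have h2 : nr (Ls g) <= nr h + nr (h - Ls g).
  by have := nrD h (Ls g - h); rewrite addrC subrK nr_distC.
have h3 : nr f * nr g <= nr f * (M * (nr h + nr (h - Ls g))).
  rewrite ler_wpM2l ?nr_ge0// (le_trans (LsM g))// ler_wpM2l//.
  exact: ltW.
move: h1 h3 hg; move: (nr (h - Ls g)) (nr h) (nr f) (nr g) => a b c d.
by move=> h1 h3 hg; nra.
Qed.

End BoundedOperator.

(** * Complexification and measurability of the spectrum *)

Section Complexification.
Variables (R : realType) (V : realHilbert R) (VC : complexHilbert R).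
Variables (j : V -> VC) (jC : complexification j).

Lemma complexification_nr x : nr (j x) = `|x|.
Proof.
have [_ _ jdot _] := jC; apply/eqP.
rewrite -(@eqrXn2 _ 2) ?nr_ge0//; apply/eqP/complexI.
by rewrite -dot_nr jdot /dotp hilbert_dotE.
Qed.

Lemma complexification_nrB x y : nr (j x - j y) = `|x - y|.
Proof.
have [jD jZ _ _] := jC; rewrite -complexification_nr jD; congr (nr (_ + _)).
by rewrite -[- y]scaleN1r jZ rmorphN rmorph1 scaleN1r.
Qed.

Lemma modCi : modC ('i%C : R[i]) = 1.
Proof. by rewrite /modC normc_def /= expr0n expr1n add0r sqrtr1. Qed.

Lemma complexification_nr_sqr x y :
  nr (j x + 'i%C *: j y) ^+ 2 = `|x| ^+ 2 + `|y| ^+ 2.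
Proof.
have [_ _ jdot _] := jC.
rewrite nr_sqrD nrZ modCi mul1r !complexification_nr dotZr jdot.
by rewrite /=; ring.
Qed.

End Complexification.

(** For real data, [complexification_nr_sqr] turns a bound of the real operator
    into a bound of its complexification. *)
Lemma operator_data_continuous (R : realType) (Ht H : complexHilbert R)
  (A : oper Ht Ht) (L : {linear Ht -> H}) : operator_data A L -> continuous L.
Proof.
case=> [//|Vt V jt j Ar Lr jtC jC _ _ _ cLr _ _ LE].
have [M M0 LM] : exists2 M : R, 0 < M & forall x, `|Lr x| <= M * `|x|.
  have /linear_boundedP/pinfty_ex_gt0[M M0 LM] : bounded_near Lr (nbhs 0).
    exact/linear_bounded_continuous.
  by exists M.
apply: (@bounded_linear _ _ _ _ (M * 2)) => z.
have [_ _ _ /(_ z)[x [y ->]]] := jtC.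
rewrite linearD linearZ /= !LE (le_trans (nrD _ _))// nrZ modCi mul1r.
rewrite !(complexification_nr jC).
have hz := complexification_nr_sqr jtC x y.
have hx : `|x| <= nr (jt x + 'i%C *: jt y).
  by rewrite -ler_sqr ?nnegrE ?nr_ge0// hz lerDl sqr_ge0.
have hy : `|y| <= nr (jt x + 'i%C *: jt y).
  by rewrite -ler_sqr ?nnegrE ?nr_ge0// hz lerDr sqr_ge0.
rewrite -mulrA mulr_natl mulr2n mulrDr lerD//.
  by rewrite (le_trans (LM _))// ler_wpM2l// ltW.
by rewrite (le_trans (LM _))// ler_wpM2l// ltW.
Qed.

Lemma operator_data_dense (R : realType) (Ht H : complexHilbert R)
  (A : oper Ht Ht) (L : {linear Ht -> H}) : operator_data A L ->
  dense (range L).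
Proof.
case=> [//|Vt V jt j Ar Lr jtC jC _ _ _ _ dLr _ LE].
have apx x (e : R) : 0 < e -> exists y, `|x - Lr y| < e.
  move=> e0; have [|z [+ [y _ yz]]] := dLr (ball x e) _ (ball_open x e).
    by exists x; exact: (ballxx x e0).
  by rewrite -yz -ball_normE; exists y.
apply/dense_nrP => z e e0; have e20 : 0 < e / 2 by rewrite divr_gt0.
have [_ _ _ /(_ z)[x [y ->]]] := jC.
have [x' xx'] := apx x _ e20; have [y' yy'] := apx y _ e20.
exists (L (jt x' + 'i%C *: jt y')); first by exists (jt x' + 'i%C *: jt y').
rewrite linearD linearZ /= !LE opprD addrACA -scalerBr.
rewrite (le_lt_trans (nrD _ _))// nrZ modCi mul1r.
by rewrite !(complexification_nrB jC) [ltRHS]splitr ltrD.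
Qed.

Section Spectrum.
Variables (R : realType) (V : complexHilbert R).

(** A small perturbation [x |-> x - C x] of the identity is bounded below, so
    that its range is closed; a vector orthogonal to that range vanishes. *)
Lemma small_perturbation (C : {linear V -> V}) (c : R) :
  0 <= c -> c < 1 -> (forall x, nr (C x) <= c * nr x) ->
  exists S : {linear V -> V}, [/\ continuous S,
    forall y, S y - C (S y) = y & forall x, S (x - C x) = x].
Proof.
move=> c0 c1 Cc; have c1' : 0 < 1 - c by rewrite subr_gt0.
have low x : (1 - c) * nr x <= nr (x - C x).
  have := nrD (x - C x) (C x); rewrite subrK; have := Cc x.
  by rewrite mulrBl mul1r; lra.
pose T x := x - C x.
have TP a u v : T (a *: u + v) = a *: T u + T v.
  by rewrite /T linearP scalerBr opprD addrACA.
have TB u v : T (u - v) = T u - T v by rewrite addrC -scaleN1r TP scaleN1r addrC.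
have sR : subspace (range T).
  split; first by exists 0 => //; rewrite /T linear0 subr0.
  by move=> a _ _ [u _ <-] [v _ <-]; exists (a *: u + v).
have clR : closed (range T).
  move=> y /closure_nrP cy.
  have /choice[x_ x_P] (n : nat) : exists x, nr (y - T x) < n.+1%:R^-1.
    have n0 : 0 < n.+1%:R^-1 :> R by rewrite invr_gt0.
    by have [_ [x _ <-] yx] := cy _ n0; exists x.
  have h0 : (fun n => 2 / (1 - c) * n.+1%:R^-1 : R) @ \oo --> (0 : R).
    rewrite -[X in _ --> X](mulr0 (2 / (1 - c))).
    by apply: cvgM; [exact: cvg_cst|exact: cvg_harmonic].
  have [x xx] : exists x : V, x_ @ \oo --> x.
    apply: (cauchy_nr_bound h0) => n m nm.
    have h := low (x_ n - x_ m); rewrite -/(T _) TB in h.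
    have h1 := nr_distD y (T (x_ n)) (T (x_ m)).
    have h2 := x_P n; have h3 := x_P m.
    have h4 : m.+1%:R^-1 <= n.+1%:R^-1 :> R by rewrite lef_pV2 ?posrE// ler_nat.
    rewrite mulrAC ler_pdivlMr// [leLHS]mulrC.
    rewrite (nr_distC y (T (x_ n))) in h2.
    apply: (le_trans h); apply: (le_trans h1); rewrite mulr_natl mulr2n.
    by apply: lerD; [exact: ltW|exact: le_trans (ltW h3) h4].
  exists x => //; apply: (@cvg_unique _ (@norm_hausdorff _ V) (T \o x_ @ \oo)).
    apply: cvgB; first exact: xx.
    by apply: continuous_cvg xx; exact: (@bounded_linear _ _ _ C c).
  by apply: (cvg_nr_bound (@cvg_harmonic R)) => n; exact/ltW/x_P.
have surj y : exists x, T x = y.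
  have [p [x _ xp] hp] := projection y clR sR.
  exists x; rewrite xp; apply/eqP; rewrite eq_sym -subr_eq0; apply/eqP.
  set w := y - p in hp *.
  have : dotp w (T w) = 0 by apply: hp; exists w.
  rewrite /T dotBr dot_nr => /eqP; rewrite subr_eq0 => /eqP wC.
  have := CS w (C w); rewrite -wC modCR ger0_norm ?sqr_ge0// => h.
  have h2 : nr w * nr (C w) <= nr w * (c * nr w) by rewrite ler_wpM2l ?nr_ge0.
  apply: nr_eq0; apply/eqP; rewrite eq_le nr_ge0 andbT leNgt; apply/negP => w0.
  have h3 := le_trans h h2; rewrite mulrCA -expr2 in h3.
  have : (1 - c) * nr w ^+ 2 <= 0 by rewrite mulrBl mul1r subr_le0.
  by rewrite leNgt mulr_gt0 ?exprn_gt0.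
have [S SP] := choice surj.
have inj u v : T u = T v -> u = v.
  move=> uv; apply/eqP; rewrite -subr_eq0; apply/eqP/nr_eq0/eqP.
  rewrite eq_le nr_ge0 andbT; have := low (u - v).
  by rewrite -/(T _) TB uv subrr nr0 pmulr_rle0.
have Slin : linear S by move=> a u v; apply: inj; rewrite TP !SP.
pose S' : {linear V -> V} := HB.pack S (GRing.isLinear.Build _ _ _ _ S Slin).
exists S'; split=> //= [|x]; last by apply: inj; rewrite SP.
apply: (@bounded_linear _ _ _ S' (1 - c)^-1) => y.
by rewrite ler_pdivlMl// (le_trans (low _))// -/(T _) [T _]SP.
Qed.

(** If [B] is the resolvent of [T] at [z], then [T - w] is the composition of
    [T - z] with [1 - (w - z) B], which is invertible when [w] is near [z]. *)
Lemma closed_spectrum (T : oper V V) : closed (spectrum T : set R[i]^o).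
Proof.
apply: open_closedC; rewrite openE => z [B [cB BT TB]].
have [M M0 BM] := linear_bounded cB.
apply/nbhs_nrP; exists (2 * M)^-1; first by rewrite invr_gt0 mulr_gt0.
move=> w zw; pose d : R[i] := w - z.
pose C : {linear V -> V} := d \*: B.
have dM : modC d * M <= 2^-1.
  have -> : modC d = nr (z - w : R[i]^o) by rewrite nr_distC.
  by rewrite -ler_pdivlMr// -invfM ltW.
have [||x|S [cS SC CS']] := @small_perturbation C 2^-1.
- lra.
- lra.
- rewrite /= nrZ (@le_trans _ _ (modC d * (M * nr x)))//.
    by rewrite ler_wpM2l ?modC_ge0.
  by rewrite mulrA ler_wpM2r ?nr_ge0.
have wE x : T x - w *: x = (T x - z *: x) - d *: x.
  by rewrite /d scalerBl opprB subrKA.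
exists (B \o S); split=> [x|y|x Tx] /=.
- by apply: continuous_comp; [exact: cS|exact: cB].
- by split; [exact: (BT (S y)).1|rewrite wE (BT (S y)).2; exact: SC].
- have := CS' (T x - z *: x); rewrite /= TB// -wE => ->.
  exact: TB.
Qed.

Lemma measurable_spectrum (T : oper V V) :
  measurable (spectrum T : set (Cborel R)).
Proof.
rewrite -[X in measurable X]setCK; apply: measurableC.
by apply: sub_sigma_algebra; apply: closed_openC; exact: closed_spectrum.
Qed.

End Spectrum.

(** * Bounded measurable functions *)

Section BoundedMeasurable.
Variable R : realType.
Local Notation C := (Cborel R).
Implicit Types (D A B : set C) (h m : C -> R[i]).

Lemma creD (a b : R[i]) : complex.Re (a + b) = complex.Re a + complex.Re b.
Proof. by case: a b => [? ?] [? ?]. Qed.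

Lemma cimD (a b : R[i]) : complex.Im (a + b) = complex.Im a + complex.Im b.
Proof. by case: a b => [? ?] [? ?]. Qed.

Lemma creB (a b : R[i]) : complex.Re (a - b) = complex.Re a - complex.Re b.
Proof. by case: a b => [? ?] [? ?]. Qed.

Lemma cimB (a b : R[i]) : complex.Im (a - b) = complex.Im a - complex.Im b.
Proof. by case: a b => [? ?] [? ?]. Qed.

Lemma measurable_continuous (f : R[i]^o -> R) : continuous f ->
  measurable_fun setT (f : C -> R).
Proof.
move=> cf; apply: (measurability _ (RGenOInfty.measurableE R)) => _ [_ [x ->] <-].
rewrite setTI; apply: sub_sigma_algebra.
by apply: open_comp => // *; exact: cf.
Qed.

Lemma continuous_Re : continuous (@complex.Re R : R[i]^o -> R).
Proof.
move=> z; apply/(@cvgrPdist_lt _ _ _ (nbhs (z : R[i]^o))) => e e0.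
have : nbhs (z : R[i]^o) [set w | nr (z - w : R[i]^o) < e].
  by apply/nbhs_nrP; exists e.
by apply: filterS => w /=; apply: le_lt_trans; rewrite -creB modC_Re.
Qed.

Lemma continuous_Im : continuous (@complex.Im R : R[i]^o -> R).
Proof.
move=> z; apply/(@cvgrPdist_lt _ _ _ (nbhs (z : R[i]^o))) => e e0.
have : nbhs (z : R[i]^o) [set w | nr (z - w : R[i]^o) < e].
  by apply/nbhs_nrP; exists e.
by apply: filterS => w /=; apply: le_lt_trans; rewrite -cimB modC_Im.
Qed.

Lemma measurable_Re : measurable_fun setT (fun z : C => complex.Re (z : R[i])).
Proof. exact: measurable_continuous continuous_Re. Qed.

Lemma measurable_Im : measurable_fun setT (fun z : C => complex.Im (z : R[i])).
Proof. exact: measurable_continuous continuous_Im. Qed.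

Definition bounded_fun_on D (f : C -> R) :=
  measurable_fun D f /\ exists M, forall z, D z -> `|f z| <= M.

(** Measurability is asked of the real and imaginary parts, since in this form
    its stability under products reduces to that for real functions. *)
Definition bounded_cfun_on D h :=
  bounded_fun_on D (fun z => complex.Re (h z)) /\
  bounded_fun_on D (fun z => complex.Im (h z)).

Lemma bounded_borel_cfun D (m : C -> C) : measurable D -> bounded_borel D m ->
  bounded_cfun_on D m.
Proof.
move=> mD [mm [M mM]]; split; split.
- exact: measurableT_comp measurable_Re mm.
- by exists M => z Dz; rewrite (le_trans (modC_Re _))// mM.
- exact: measurableT_comp measurable_Im mm.
- by exists M => z Dz; rewrite (le_trans (modC_Im _))// mM.
Qed.

Section Closure.
Variable D : set C.
Hypothesis mD : measurable D.

Lemma bounded_funD f g : bounded_fun_on D f -> bounded_fun_on D g ->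
  bounded_fun_on D (fun z => f z + g z).
Proof.
move=> [mf [M fM]] [mg [N gN]]; split; first exact: measurable_funD.
exists (M + N) => z Dz; rewrite (le_trans (ler_normD _ _))// lerD ?fM//.
exact: gN.
Qed.

Lemma bounded_funM f g : bounded_fun_on D f -> bounded_fun_on D g ->
  bounded_fun_on D (fun z => f z * g z).
Proof.
move=> [mf [M fM]] [mg [N gN]]; split; first exact: measurable_funM.
by exists (M * N) => z Dz; rewrite normrM ler_pM ?fM ?gN.
Qed.

Lemma bounded_fun_cst (c : R) : bounded_fun_on D (fun=> c).
Proof. by split; [exact: measurable_cst|exists `|c|]. Qed.

Lemma bounded_funB f g : bounded_fun_on D f -> bounded_fun_on D g ->
  bounded_fun_on D (fun z => f z - g z).
Proof.
move=> [mf [M fM]] [mg [N gN]]; split; first exact: measurable_funB.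
exists (M + N) => z Dz; rewrite (le_trans (ler_normB _ _))// lerD ?fM//.
exact: gN.
Qed.

Lemma bounded_fun_indic A : measurable A -> bounded_fun_on D (\1_A).
Proof.
move=> mA; split; first exact: measurable_indic.
by exists 1 => z _; rewrite indicE; case: (_ \in _); rewrite ?normr1// normr0.
Qed.

Lemma bounded_cfun_cst (c : R[i]) : bounded_cfun_on D (fun=> c).
Proof. by split; exact: bounded_fun_cst. Qed.

Lemma bounded_cfunD h1 h2 : bounded_cfun_on D h1 -> bounded_cfun_on D h2 ->
  bounded_cfun_on D (fun z => h1 z + h2 z).
Proof.
move=> [r1 i1] [r2 i2]; split.
  by under eq_fun do rewrite creD; exact: bounded_funD.
by under eq_fun do rewrite cimD; exact: bounded_funD.
Qed.

Lemma creM (a b : R[i]) : complex.Re (a * b) =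
  complex.Re a * complex.Re b - complex.Im a * complex.Im b.
Proof. by case: a b => [? ?] [? ?]. Qed.

Lemma cimM (a b : R[i]) : complex.Im (a * b) =
  complex.Re a * complex.Im b + complex.Im a * complex.Re b.
Proof. by case: a b => [? ?] [? ?]. Qed.

Lemma bounded_cfunM h1 h2 : bounded_cfun_on D h1 -> bounded_cfun_on D h2 ->
  bounded_cfun_on D (fun z => h1 z * h2 z).
Proof.
move=> [r1 i1] [r2 i2]; split.
  under eq_fun do rewrite creM.
  by apply: bounded_funB; exact: bounded_funM.
under eq_fun do rewrite cimM.
by apply: bounded_funD; exact: bounded_funM.
Qed.

Lemma bounded_cfun_indic A : measurable A ->
  bounded_cfun_on D (fun z => ((\1_A z : R)%:C)%C).
Proof.
by move=> mA; split => /=; [exact: bounded_fun_indic|exact: bounded_fun_cst].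
Qed.

Lemma bounded_cfun_lin a h1 h2 : bounded_cfun_on D h1 ->
  bounded_cfun_on D h2 -> bounded_cfun_on D (fun z => a * h1 z + h2 z).
Proof.
move=> ? ?; apply: bounded_cfunD => //; apply: bounded_cfunM => //.
exact: bounded_cfun_cst.
Qed.

Lemma bounded_cfunP h : bounded_cfun_on D h ->
  exists2 M : R, 0 <= M & forall z, D z -> modC (h z) <= M.
Proof.
move=> [[_ [M hM]] [_ [N hN]]]; exists (`|M| + `|N|); first exact: addr_ge0.
move=> z Dz; rewrite (le_trans (modC_ReIm _))//.
by rewrite lerD// (le_trans _ (ler_norm _))// ?hM ?hN.
Qed.

Lemma measurable_modC h : bounded_cfun_on D h ->
  measurable_fun D (fun z => modC (h z)).
Proof.
move=> [[mr _] [mi _]].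
rewrite (_ : (fun z => modC (h z)) = Num.sqrt \o
  (fun z => complex.Re (h z) ^+ 2 + complex.Im (h z) ^+ 2)); last first.
  by apply/funext => z; rewrite /modC normc_def.
apply: (@measurable_comp _ _ _ _ _ _ setT) => //.
  by apply: continuous_measurable_fun; exact: sqrt_continuous.
by apply: measurable_funD; exact: measurable_funX.
Qed.

(** Values are rounded down to multiples of [e]: [q] is the index of the
    multiple, and boundedness makes it range over finitely many integers. *)
Lemma quantize_real (f : C -> R) (e : R) : 0 < e -> bounded_fun_on D f ->
  exists n (q : C -> nat) (a : nat -> R),
    [/\ forall z, D z -> (q z < n)%N,
      forall p, measurable (D `&` q @^-1` [set p])
    & forall z, D z -> `|f z - a (q z)| <= e].
Proof.
move=> e0 [mf [M fM]].
pose q z := Num.truncn ((f z + M) / e).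
have qp z : D z -> 0 <= (f z + M) / e.
  move=> /fM; rewrite ler_norml => /andP[h _].
  by rewrite divr_ge0 ?(ltW e0)// -lerBlDr sub0r.
have qE z p : D z ->
    (q z == p) = (p%:R * e - M <= f z < p.+1%:R * e - M).
  move=> /qp h; rewrite truncn_eq// ler_pdivlMr// ltr_pdivrMr//.
  by rewrite lerBlDr ltrBrDr.
exists (Num.truncn ((M + M) / e)).+1, q, (fun p => p%:R * e - M); split.
- move=> z Dz; rewrite ltnS; apply: le_truncn.
  rewrite ler_pM2r ?invr_gt0// lerD2r.
  by rewrite (le_trans (ler_norm _))// fM.
- move=> p; rewrite (_ : _ `&` _ =
      D `&` f @^-1` `[p%:R * e - M, p.+1%:R * e - M[%classic).
    by apply: mf => //; exact: measurable_itv.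
  apply/seteqP; split=> z [Dz] /=; rewrite in_itv /=.
    by move=> qz; split => //; rewrite -qE// qz.
  by rewrite -qE// => /eqP.
- move=> z Dz; have := qE z (q z) Dz; rewrite eqxx => /esym/andP[h1 h2].
  rewrite ger0_norm ?subr_ge0// lerBlDr (le_trans (ltW h2))//.
  by rewrite -natr1; lra.
Qed.

(** The two indices for the real and imaginary parts are packed into one by
    division with remainder. *)
Lemma quantize h (e : R) : 0 < e -> bounded_cfun_on D h ->
  exists n (q : C -> nat) (a : nat -> R[i]),
    [/\ forall z, D z -> (q z < n)%N,
      forall p, measurable (D `&` q @^-1` [set p])
    & forall z, D z -> modC (h z - a (q z)) <= e].
Proof.
move=> e0 [hr hi]; have e20 : 0 < e / 2 by rewrite divr_gt0.
have [n1 [q1 [a1 [n1P m1 c1]]]] := quantize_real e20 hr.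
have [n2 [q2 [a2 [n2P m2 c2]]]] := quantize_real e20 hi.
have qd z : D z -> ((q1 z * n2 + q2 z) %/ n2 = q1 z)%N.
  move=> Dz; have q2n := n2P z Dz.
  by rewrite divnMDl ?(leq_ltn_trans _ q2n)// divn_small ?addn0.
have qm z : D z -> ((q1 z * n2 + q2 z) %% n2 = q2 z)%N.
  by move=> Dz; rewrite modnMDl modn_small// n2P.
exists (n1 * n2)%N, (fun z => q1 z * n2 + q2 z)%N,
  (fun p => (a1 (p %/ n2) +i* a2 (p %% n2))%C)%N; split.
- move=> z Dz; have := n1P z Dz; have := n2P z Dz => h2 h1.
  apply: (@leq_trans (q1 z * n2 + n2)%N); first by rewrite ltn_add2l.
  by rewrite -mulSnr leq_mul2r h1 orbT.
- move=> p; have [pn|pn] := boolP ((p %% n2 < n2)%N); last first.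
    rewrite (_ : _ `&` _ = set0)//; apply/seteqP; split=> // z [Dz] /= zp.
    by move: pn; rewrite -zp qm// n2P.
  rewrite (_ : _ `&` _ = (D `&` q1 @^-1` [set (p %/ n2)%N]) `&`
      (D `&` q2 @^-1` [set (p %% n2)%N])); first exact: measurableI.
  apply/seteqP; split=> z /=.
    by move=> [Dz <-]; rewrite qd// qm.
  by move=> [[Dz ->] [_ ->]]; rewrite -divn_eq.
- move=> z Dz; rewrite qd// qm//.
  have := c1 z Dz; have := c2 z Dz; case: (h z) => x y /= h2 h1.
  by rewrite (le_trans (modC_ReIm _))//= [leRHS]splitr lerD.
Qed.

Definition level (q : C -> nat) p := D `&` q @^-1` [set p].

Definition simple (q : C -> nat) (a : nat -> R[i]) n : C -> R[i] :=
  fun z => \sum_(p < n) a p * ((\1_(level q p) z : R)%:C)%C.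

Lemma simpleE q a n z : D z -> (q z < n)%N -> simple q a n z = a (q z).
Proof.
move=> Dz zn; rewrite /simple (bigD1 (Ordinal zn))//= big1 ?addr0.
  by rewrite indicE mem_set ?mulr1.
move=> p pz; rewrite indicE memNset ?mulr0// => -[_ /= qz].
by move/negP: pz; apply; apply/eqP/val_inj.
Qed.

Lemma simpleS q a n : simple q a n.+1 =
  (fun z => a n * ((\1_(level q n) z : R)%:C)%C + simple q a n z).
Proof. by apply/funext => z; rewrite /simple big_ord_recr/= addrC. Qed.

Lemma simple0 q a : simple q a 0 = (fun=> 0).
Proof. by apply/funext => z; rewrite /simple big_ord0. Qed.

Lemma bounded_cfun_simple q a n : (forall p, measurable (level q p)) ->
  bounded_cfun_on D (simple q a n).
Proof.
move=> mq; elim: n => [|n ih]; first by rewrite simple0; exact: bounded_cfun_cst.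
rewrite simpleS; apply: bounded_cfun_lin => //; exact: bounded_cfun_indic (mq n).
Qed.

Lemma bounded_cfunB h1 h2 : bounded_cfun_on D h1 -> bounded_cfun_on D h2 ->
  bounded_cfun_on D (fun z => h1 z - h2 z).
Proof.
move=> b1 b2; have := bounded_cfun_lin (-1) b2 b1; congr bounded_cfun_on.
by apply/funext => z; rewrite mulN1r addrC.
Qed.

Definition bounded_functional (F : (C -> R[i]) -> R[i]) :=
  (forall a h1 h2, bounded_cfun_on D h1 -> bounded_cfun_on D h2 ->
     F (fun z => a * h1 z + h2 z) = a * F h1 + F h2) /\
  exists2 K : R, 0 <= K & forall h M, bounded_cfun_on D h -> 0 <= M ->
     (forall z, D z -> modC (h z) <= M) -> modC (F h) <= M * K.

Lemma bounded_functionalB F h1 h2 : bounded_functional F ->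
  bounded_cfun_on D h1 -> bounded_cfun_on D h2 ->
  F (fun z => h1 z - h2 z) = F h1 - F h2.
Proof.
move=> [Flin _] b1 b2; rewrite [RHS]addrC -mulN1r -Flin//; congr F.
by apply/funext => z; rewrite mulN1r addrC.
Qed.

(** Simple functions are uniformly dense in the bounded measurable functions,
    so a bounded functional is determined by its values on indicators. *)
Lemma bounded_functional_ext F G : bounded_functional F ->
  bounded_functional G ->
  (forall A, measurable A ->
     F (fun z => ((\1_A z : R)%:C)%C) = G (fun z => ((\1_A z : R)%:C)%C)) ->
  forall h, bounded_cfun_on D h -> F h = G h.
Proof.
move=> bF bG FG h bh; have [Flin [K K0 KP]] := bF.
have [Glin [L L0 LP]] := bG.
apply/eqP; rewrite -subr_eq0; apply/eqP/modC_eq0/eqP.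
rewrite eq_le modC_ge0 andbT; apply/ler_addgt0Pr => e e0; rewrite add0r.
have KL : 0 < K + L + 1 by rewrite ltr_pwDr// addr_ge0.
pose d := e / (K + L + 1); have d0 : 0 < d by rewrite divr_gt0.
have [n [q [a [qn mq hq]]]] := quantize d0 bh.
have bs k : bounded_cfun_on D (simple q a k) by exact: bounded_cfun_simple.
have FGs k : F (simple q a k) = G (simple q a k).
  elim: k => [|k ih].
    rewrite (_ : simple q a 0 = fun z => ((\1_set0 z : R)%:C)%C) ?FG//.
    by rewrite simple0; apply/funext => z; rewrite indicE in_set0.
  have bl := bounded_cfun_indic (mq k).
  by rewrite simpleS Flin// Glin// ih FG//; exact: (mq k).
have bd := bounded_cfunB bh (bs n).
have hs z : D z -> modC (h z - simple q a n z) <= d.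
  by move=> Dz; rewrite simpleE ?qn ?hq.
have := KP _ _ bd (ltW d0) hs; have := LP _ _ bd (ltW d0) hs.
rewrite !bounded_functionalB// FGs.
set x := F h; set y := G h; set w := G (simple _ _ _) => Hy Hx.
have := modCD (x - w) (- (y - w)).
have -> : modC (- (y - w)) = modC (y - w) by rewrite /modC normrN.
rewrite opprB subrKA => H.
have dE : d * (K + L) <= e.
  rewrite /d mulrAC ler_pdivrMr//; apply: ler_wpM2l; first exact: ltW.
  by rewrite lerDl.
by rewrite (le_trans H)// (le_trans _ dE)// mulrDr lerD.
Qed.

End Closure.
End BoundedMeasurable.

(** * Integration against complex measures *)

Section FiniteMeasureIntegral.
Variables (R : realType) (D : set (Cborel R)).
Local Notation C := (Cborel R).
Hypothesis mD : measurable D.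
Implicit Types f g : C -> R.

Section FiniteMeasure.
Variable mu : {finite_measure set C -> \bar R}.

Lemma bounded_fun_integrable f : bounded_fun_on D f ->
  mu.-integrable D (EFin \o f).
Proof.
move=> [mf [M fM]]; apply: measurable_bounded_integrable => //.
  by rewrite ltey_eq fin_num_measure.
exists M; split; first by rewrite num_real.
by move=> x Mx z Dz /=; rewrite (le_trans (fM z Dz))// ltW.
Qed.

Lemma Rintegral_indic A : measurable A ->
  Rintegral mu D (\1_A) = fine (mu (A `&` D)).
Proof. by move=> mA; rewrite /Rintegral integral_indic. Qed.

Lemma Rintegral_le_bound f M : bounded_fun_on D f ->
  (forall z, D z -> `|f z| <= M) -> `|Rintegral mu D f| <= M * fine (mu D).
Proof.
move=> bf fM; rewrite (le_trans (le_normr_Rintegral _ _))//.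
  exact: bounded_fun_integrable.
rewrite -Rintegral_cst//; apply: le_Rintegral => //.
- apply: bounded_fun_integrable; split; first by apply: measurableT_comp bf.1.
  by exists M => z Dz; rewrite normr_id; exact: fM.
- by apply: bounded_fun_integrable; exact: bounded_fun_cst.
Qed.

End FiniteMeasure.

Variable mu : {charge set C -> \bar R}.

Lemma charge_integral_lin a f g : bounded_fun_on D f -> bounded_fun_on D g ->
  charge_integral mu D (fun z => a * f z + g z) =
  a * charge_integral mu D f + charge_integral mu D g.
Proof.
move=> bf bg; rewrite /charge_integral.
case: cid => P exN; case: cid => N muPN.
have baf : bounded_fun_on D (fun z => a * f z).
  by apply: bounded_funM => //; exact: bounded_fun_cst.
do 2 (rewrite RintegralD//; [|exact: bounded_fun_integrable..]).
do 2 (rewrite RintegralZl//; [|exact: bounded_fun_integrable..]).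
by rewrite mulrBr opprD addrACA.
Qed.

Lemma charge_integral_indic A : measurable A ->
  charge_integral mu D (\1_A) = fine (mu (A `&` D)).
Proof.
move=> mA; rewrite /charge_integral.
case: cid => P exN; case: cid => N muPN.
rewrite !Rintegral_indic// (jordan_decomp muPN); last exact: measurableI.
have mAD : measurable (A `&` D) by exact: measurableI.
rewrite /cadd /= cscaleN1 fineD ?fin_num_measure//.
  by rewrite fineN.
by rewrite fin_numN fin_num_measure.
Qed.

Lemma charge_integral_le_bound : exists2 K : R, 0 <= K & forall f M,
  bounded_fun_on D f -> (forall z, D z -> `|f z| <= M) ->
  `|charge_integral mu D f| <= M * K.
Proof.
rewrite /charge_integral; case: cid => P exN; case: cid => N muPN.
exists (fine (jordan_pos muPN D) + fine (jordan_neg muPN D)).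
  by rewrite addr_ge0// fine_ge0.
move=> f M bf fM; rewrite (le_trans (ler_normB _ _))// mulrDr.
by rewrite lerD//; exact: Rintegral_le_bound.
Qed.

Lemma eq_charge_integral f g : {in D, f =1 g} ->
  charge_integral mu D f = charge_integral mu D g.
Proof.
move=> fg; rewrite /charge_integral.
by case: cid => P exN; case: cid => N muPN; congr (_ - _); exact: eq_Rintegral.
Qed.

End FiniteMeasureIntegral.

Section ComplexMeasureIntegral.
Variables (R : realType).
Local Notation C := (Cborel R).
Implicit Types (nu : set C -> R[i]) (D : set C) (h : C -> R[i]).

(** [charge_of] chooses a charge that agrees with its argument on measurable
    sets; the real and imaginary parts of a complex measure do have one. *)
Lemma charge_of_part (p : R[i]^o -> R) nu : continuous p ->
  (forall a b : R[i], p (a + b) = p a + p b) -> is_cmeasure nu ->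
  forall A, measurable A ->
    charge_of (fun A => (p (nu A))%:E) A = (p (nu A))%:E.
Proof.
move=> cp pD [nu0 nuS] A mA.
have p0 : p 0 = 0 by apply: (addrI (p 0)); rewrite -pD !addr0.
rewrite /charge_of; case: pselect => [ex|nex].
  by case: cid => mu' /= ->.
exfalso; apply: nex.
pose mu A := (p (nu A))%:E.
have mu0 : mu set0 = 0%E by rewrite /mu nu0 p0.
have muf A' : measurable A' -> mu A' \is a fin_num by [].
have muS : semi_sigma_additive mu.
  move=> F mF tF _.
  have -> : (fun n => (\sum_(0 <= i < n) mu (F i))%E) =
      EFin \o (p \o (fun n => \sum_(i < n) nu (F i) : R[i]^o)).
    apply/funext => n /=; rewrite sumEFin big_mkord; congr EFin.
    by elim/big_ind2: _ => [|x y z w|//]; rewrite ?p0// => -> ->; rewrite pD.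
  have cn : (p \o (fun n => \sum_(i < n) nu (F i) : R[i]^o)) @ \oo -->
      p (nu (\bigcup_i F i)).
    by apply: continuous_cvg; [exact: cp|exact: nuS].
  by apply: (cvg_EFin _ cn); exact: nearW.
pose mu' : {charge set C -> \bar R} :=
  HB.pack mu (isCharge.Build _ _ _ mu mu0 muf muS).
by exists mu'.
Qed.

Lemma charge_of_Re nu A : is_cmeasure nu -> measurable A ->
  charge_of (fun A => (complex.Re (nu A))%:E) A = (complex.Re (nu A))%:E.
Proof.
by move=> cnu; apply: (charge_of_part (@continuous_Re R)) => // a b; exact: creD.
Qed.

Lemma charge_of_Im nu A : is_cmeasure nu -> measurable A ->
  charge_of (fun A => (complex.Im (nu A))%:E) A = (complex.Im (nu A))%:E.
Proof.
by move=> cnu; apply: (charge_of_part (@continuous_Im R)) => // a b; exact: cimD.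
Qed.

Section Fixed.
Variables (D : set C) (mD : measurable D).

Lemma cmeasure_integral_lin nu a h1 h2 :
  bounded_cfun_on D h1 -> bounded_cfun_on D h2 ->
  cmeasure_integral nu D (fun z => a * h1 z + h2 z) =
  a * cmeasure_integral nu D h1 + cmeasure_integral nu D h2.
Proof.
move=> [r1 i1] [r2 i2]; rewrite /cmeasure_integral.
set mr := charge_of _; set mi := charge_of _.
have bs f g b c : bounded_fun_on D f -> bounded_fun_on D g ->
    bounded_fun_on D (fun z => b * f z + c * g z).
  by move=> bf bg; apply: bounded_funD => //; apply: bounded_funM => //;
    exact: bounded_fun_cst.
have lin3 mu f1 f2 f3 b c : bounded_fun_on D f1 -> bounded_fun_on D f2 ->
    bounded_fun_on D f3 ->
    charge_integral mu D (fun z => b * f1 z + (c * f2 z + f3 z)) =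
    b * charge_integral mu D f1 + (c * charge_integral mu D f2 +
      charge_integral mu D f3).
  move=> b1 b2 b3; rewrite charge_integral_lin// ?charge_integral_lin//.
  by apply: bounded_funD => //; apply: bounded_funM => //; exact: bounded_fun_cst.
have reE : (fun z => complex.Re (a * h1 z + h2 z)) = (fun z =>
    complex.Re a * complex.Re (h1 z) +
    (- complex.Im a * complex.Im (h1 z) + complex.Re (h2 z))).
  by apply/funext => z; rewrite creD creM mulNr addrA.
have imE : (fun z => complex.Im (a * h1 z + h2 z)) = (fun z =>
    complex.Re a * complex.Im (h1 z) +
    (complex.Im a * complex.Re (h1 z) + complex.Im (h2 z))).
  by apply/funext => z; rewrite cimD cimM addrA.
rewrite reE imE !lin3//; case: a {reE imE} => ar ai /=.
by apply/eqP; rewrite eq_complex /=; apply/andP; split; apply/eqP; ring.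
Qed.

Lemma cmeasure_integral_indic nu A : is_cmeasure nu -> measurable A ->
  cmeasure_integral nu D (fun z => ((\1_A z : R)%:C)%C) = nu (A `&` D).
Proof.
move=> cnu mA; rewrite /cmeasure_integral /=.
have mAD : measurable (A `&` D) by exact: measurableI.
have i0 mu : charge_integral mu D (fun=> 0) = 0.
  have := @charge_integral_lin _ _ mD mu (-1) _ _ (bounded_fun_cst D 0) (bounded_fun_cst D 0).
  under eq_charge_integral do rewrite mulr0 addr0.
  by rewrite mulN1r addrC subrr.
rewrite !i0 !charge_integral_indic// charge_of_Re// charge_of_Im//=.
by rewrite subr0 addr0; case: (nu _).
Qed.

Lemma cmeasure_integral_simple nu q a n : is_cmeasure nu ->
  (forall p, measurable (level D q p)) ->
  cmeasure_integral nu D (simple D q a n) =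
  \sum_(p < n) a p * nu (level D q p).
Proof.
move=> cnu mq; elim: n => [|n ih].
  rewrite simple0 big_ord0 (_ : (fun=> 0) = fun z => ((\1_set0 z : R)%:C)%C).
    by rewrite cmeasure_integral_indic// set0I; exact: cnu.1.
  by apply/funext => z; rewrite indicE in_set0.
rewrite simpleS cmeasure_integral_lin ?ih ?big_ord_recr/=.
- rewrite cmeasure_integral_indic// [LHS]addrC.
  by rewrite (@setIidl _ (level D q n))// => z [].
- exact: bounded_cfun_indic (mq n).
- exact: bounded_cfun_simple.
Qed.

Lemma cmeasure_integral_le_bound nu : exists2 K : R, 0 <= K & forall h M,
  bounded_cfun_on D h -> (forall z, D z -> modC (h z) <= M) ->
  modC (cmeasure_integral nu D h) <= M * K.
Proof.
rewrite /cmeasure_integral.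
set mr := charge_of _; set mi := charge_of _.
have [K1 K10 K1P] := charge_integral_le_bound mD mr.
have [K2 K20 K2P] := charge_integral_le_bound mD mi.
exists ((K1 + K2) + (K2 + K1)); first by rewrite !addr_ge0.
move=> h M [br bi] hM; rewrite (le_trans (modC_ReIm _))//=.
have hr z : D z -> `|complex.Re (h z)| <= M.
  by move=> Dz; rewrite (le_trans (modC_Re _))// hM.
have hi z : D z -> `|complex.Im (h z)| <= M.
  by move=> Dz; rewrite (le_trans (modC_Im _))// hM.
rewrite mulrDr lerD//.
  by rewrite (le_trans (ler_normB _ _))// mulrDr lerD// ?K1P ?K2P.
by rewrite (le_trans (ler_normD _ _))// mulrDr lerD// ?K1P ?K2P.
Qed.

Lemma eq_cmeasure_integral nu h1 h2 : {in D, h1 =1 h2} ->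
  cmeasure_integral nu D h1 = cmeasure_integral nu D h2.
Proof.
move=> h12; rewrite /cmeasure_integral.
by congr ((_ - _) +i* (_ + _))%C; apply: eq_charge_integral => z Dz;
  rewrite h12.
Qed.

Lemma cmeasure_integralB nu h1 h2 :
  bounded_cfun_on D h1 -> bounded_cfun_on D h2 ->
  cmeasure_integral nu D (fun z => h1 z - h2 z) =
  cmeasure_integral nu D h1 - cmeasure_integral nu D h2.
Proof.
move=> b1 b2; rewrite [RHS]addrC -mulN1r -cmeasure_integral_lin//.
by apply: eq_cmeasure_integral => z _; rewrite mulN1r addrC.
Qed.

Lemma cmeasure_integral_functional nu :
  bounded_functional D (cmeasure_integral nu D).
Proof.
split; first by move=> a h1 h2; exact: cmeasure_integral_lin.
have [K K0 KP] := cmeasure_integral_le_bound nu; exists K => // h M bh _.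
exact: KP.
Qed.

(** Both sides are bounded functionals of [h], and the hypothesis on the measures
    is their equality on indicator functions. *)
Lemma cmeasure_integral_measure_lin nu nu1 nu2 a h :
  is_cmeasure nu -> is_cmeasure nu1 -> is_cmeasure nu2 ->
  (forall A, measurable A -> A `<=` D -> nu A = a * nu1 A + nu2 A) ->
  bounded_cfun_on D h ->
  cmeasure_integral nu D h =
  a * cmeasure_integral nu1 D h + cmeasure_integral nu2 D h.
Proof.
move=> c c1 c2 nuE; pose G h :=
  a * cmeasure_integral nu1 D h + cmeasure_integral nu2 D h.
move: h; apply: (@bounded_functional_ext _ _ mD _ G).
- exact: cmeasure_integral_functional.
- have [l1 [K1 K10 K1P]] := cmeasure_integral_functional nu1.
  have [l2 [K2 K20 K2P]] := cmeasure_integral_functional nu2.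
  split=> [b h1 h2 b1 b2|]; first by rewrite /G l1// l2//; ring.
  exists (modC a * K1 + K2); first by rewrite addr_ge0// mulr_ge0// modC_ge0.
  move=> h M bh M0 hM; rewrite (le_trans (modCD _ _))// mulrDr.
  rewrite lerD ?K2P// modCM mulrCA ler_wpM2l ?modC_ge0//.
  exact: K1P.
- move=> A mA; rewrite /G !cmeasure_integral_indic// nuE ?subIsetr//.
  exact: measurableI.
Qed.

Lemma eq_cmeasure_integral_measure nu1 nu2 h :
  is_cmeasure nu1 -> is_cmeasure nu2 ->
  (forall A, measurable A -> A `<=` D -> nu1 A = nu2 A) ->
  bounded_cfun_on D h ->
  cmeasure_integral nu1 D h = cmeasure_integral nu2 D h.
Proof.
move=> c1 c2 E bh.
rewrite (@cmeasure_integral_measure_lin nu1 nu1 nu2 0)//.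
  by rewrite mul0r add0r.
by move=> A mA AD; rewrite mul0r add0r E.
Qed.

End Fixed.
End ComplexMeasureIntegral.

(** * The total variation is a measure *)

Section TotalVariation.
Variable (R : realType).
Local Notation C := (Cborel R).
Implicit Types (A B : set C).

Section Variation.
Variable nu : set C -> R[i].
Hypothesis cnu : is_cmeasure nu.
Local Notation V := (cmeasure_variation nu).
Local Open Scope ereal_scope.

Let term B : \bar R := (modC (nu B))%:E.

Let term_ge0 B : 0 <= term B.
Proof. by rewrite lee_fin modC_ge0. Qed.

Let term0 : term set0 = 0.
Proof. by rewrite /term cnu.1 modCR normr0. Qed.

Lemma variation_partition A (B : (set C)^nat) :
  (forall i, measurable (B i)) -> trivIset setT B -> \bigcup_i B i = A ->
  \sum_(0 <= i <oo) (modC (nu (B i)))%:E <= V A.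
Proof. by move=> mB tB BA; apply: ereal_sup_ubound; exists B. Qed.

Let single A n : set C := if n is 0%N then A else set0.

Let single_partition A : measurable A -> [/\ forall i, measurable (single A i),
  trivIset setT (single A) & \bigcup_i single A i = A].
Proof.
move=> mA; split; first by case => [//|i]; exact: measurable0.
  by apply/trivIsetP => -[|i] [|j] _ _ //= _; rewrite /single ?setI0 ?set0I.
by apply/seteqP; split=> [z [[//|i] _ []]|z Az]; exists 0%N.
Qed.

Lemma modC_le_variation A : measurable A -> (modC (nu A))%:E <= V A.
Proof.
move=> mA; have [mB tB BA] := single_partition mA.
apply: le_trans (variation_partition mB tB BA).
have := @nneseries_lim_ge R (fun i => term (single A i)) xpredT 0 1
  (fun n _ _ => term_ge0 _).
by rewrite big_nat1.
Qed.

Lemma variation_ge0 A : measurable A -> 0 <= V A.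
Proof.
by move=> mA; apply: le_trans (modC_le_variation mA); exact: term_ge0.
Qed.

Lemma variation0 : V set0 = 0.
Proof.
apply/eqP; rewrite eq_le variation_ge0// andbT.
apply: ge_ereal_sup => _ [B [_ _ B0 ->]].
have Bi i : B i = set0 by apply/seteqP; split=> // z Bz; rewrite -B0; exists i.
by rewrite eseries0// => i _ _; rewrite Bi; exact: term0.
Qed.

(** Partitions of two disjoint sets interleave into one of their union. *)
Lemma variation_superadditive A A' : measurable A -> measurable A' ->
  A `&` A' = set0 -> V A + V A' <= V (A `|` A').
Proof.
move=> mA mA' AA'.
have key (B B' : (set C)^nat) : (forall i, measurable (B i)) ->
    trivIset setT B -> \bigcup_i B i = A -> (forall i, measurable (B' i)) ->
    trivIset setT B' -> \bigcup_i B' i = A' ->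
    \sum_(0 <= i <oo) term (B i) + \sum_(0 <= i <oo) term (B' i)
      <= V (A `|` A').
  move=> mB tB BA mB' tB' BA'.
  rewrite -nneseriesD//.
  pose E n := if odd n then B' n./2 else B n./2.
  have E0 n : E n.*2 = B n by rewrite /E odd_double doubleK.
  have E1 n : E n.*2.+1 = B' n by rewrite /E /= odd_double /= uphalf_double.
  have disj i j z : B i z -> B' j z -> False.
    by move=> Bz B'z; have : (A `&` A') z by [split; [rewrite -BA; exists i|
      rewrite -BA'; exists j]]; rewrite AA'.
  have mE n : measurable (E n) by rewrite /E; case: ifP.
  have tE : trivIset setT E.
    move=> i j _ _ [z []]; rewrite /E.
    have hd k : k = (odd k + k./2.*2)%N by rewrite odd_double_half.
    case oi : (odd i); case oj : (odd j) => zi zj.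
    - by rewrite (hd i) (hd j) oi oj (tB' _ _ I I (ex_intro _ z (conj zi zj))).
    - by case: (disj _ _ _ zj zi).
    - by case: (disj _ _ _ zi zj).
    - by rewrite (hd i) (hd j) oi oj (tB _ _ I I (ex_intro _ z (conj zi zj))).
  have UE : \bigcup_i E i = A `|` A'.
    apply/seteqP; split=> [z [i _]|z [|]].
    - by rewrite /E; case: ifP => _ zi; [right; rewrite -BA'|left; rewrite -BA];
        exists i./2.
    - by rewrite -BA => -[i _ zi]; exists i.*2; rewrite ?E0.
    - by rewrite -BA' => -[i _ zi]; exists i.*2.+1; rewrite ?E1.
  apply: le_trans (variation_partition mE tE UE).
  apply: lime_le; first by apply: is_cvg_nneseries => n _ _; exact: adde_ge0.
  apply: nearW => n.
  have := @nneseries_lim_ge R (fun i => term (E i)) xpredT 0 n.*2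
    (fun n _ _ => term_ge0 _).
  apply: le_trans; rewrite le_eqVlt; apply/orP; left; apply/eqP.
  elim: n => [|n ih]; first by rewrite !big_geq.
  by rewrite doubleS !big_nat_recr//= -ih E0 E1 addeA.
case: (leP +oo (V (A `|` A'))) => [|]; first by rewrite leye_eq => /eqP ->; exact: leey.
move=> Vfin.
have Vn : V (A `|` A') \is a fin_num.
  by rewrite ge0_fin_numE// variation_ge0//; exact: measurableU.
have bnd (B' : (set C)^nat) : (forall i, measurable (B' i)) -> trivIset setT B' ->
    \bigcup_i B' i = A' ->
    V A + \sum_(0 <= i <oo) term (B' i) <= V (A `|` A').
  move=> mB' tB' BA'; set x := (X in _ + X).
  have x0 : 0 <= x by exact: nneseries_ge0.
  have xV : x <= V (A `|` A').
    have [mB tB BA] := single_partition mA.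
    apply: le_trans (key _ _ mB tB BA mB' tB' BA').
    by rewrite leeDr//; exact: nneseries_ge0.
  have xn : x \is a fin_num by rewrite ge0_fin_numE// (le_lt_trans xV).
  rewrite -leeBrDr//; apply: ge_ereal_sup => _ [B [mB tB BA ->]].
  by rewrite leeBrDr//; exact: key.
have VA : V A <= V (A `|` A').
  have [mB' tB' BA'] := single_partition mA'.
  apply: le_trans (bnd _ mB' tB' BA').
  by rewrite leeDl//; exact: nneseries_ge0.
have VAn : V A \is a fin_num.
  by rewrite ge0_fin_numE ?variation_ge0// (le_lt_trans VA).
rewrite -leeBrDl//; apply: ge_ereal_sup => _ [B [mB tB BA ->]].
by rewrite leeBrDl//; exact: bnd.
Qed.

Lemma le_variation A B : measurable A -> measurable B -> A `<=` B -> V A <= V B.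
Proof.
move=> mA mB AB.
have h : V A + V (B `\` A) <= V (A `|` (B `\` A)).
  apply: variation_superadditive => //; first exact: measurableD.
  exact: setDIK.
rewrite setDUK// in h; apply: le_trans h; rewrite leeDl//.
by apply: variation_ge0; exact: measurableD.
Qed.

(** Each block of a partition of the union is cut along the [A i]. *)
Lemma variation_subadditive (A : (set C)^nat) :
  (forall i, measurable (A i)) -> trivIset setT A ->
  V (\bigcup_i A i) <= \sum_(0 <= i <oo) V (A i).
Proof.
move=> mA tA; apply: ge_ereal_sup => _ [B [mB tB BA ->]].
have mBA j i : measurable (B j `&` A i) by exact: measurableI.
have cut j : term (B j) <= \sum_(0 <= i <oo) term (B j `&` A i).
  have BjE : B j = \bigcup_i (B j `&` A i).
    rewrite -setI_bigcupr -BA; apply/esym/setIidPl => z Bz; by exists j.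
  have tBA : trivIset setT (fun i => B j `&` A i).
    exact: trivIset_setIl.
  have := cnu.2 _ (mBA j) tBA; rewrite -BjE => /cvg_nr h.
  have h' : (fun n => (modC (\sum_(i < n) nu (B j `&` A i)))%:E) @ \oo
      --> term (B j).
    by apply: cvg_EFin; [exact: nearW|exact: h].
  rewrite -(cvg_lim _ h')//; apply: lee_lim.
  - by apply/cvg_ex; exists (term (B j)).
  - exact: is_cvg_nneseries.
  - apply: nearW => n; rewrite sumEFin lee_fin big_mkord.
    elim/big_ind2: _ => [|x x' y y' h1 h2|//]; first by rewrite modCR normr0.
    by rewrite (le_trans (modCD _ _))// lerD.
apply: (@le_trans _ _ (\sum_(0 <= j <oo) \sum_(0 <= i <oo) term (B j `&` A i))).
  by apply: lee_nneseries => [j _ _|j _]; [exact: term_ge0|exact: cut].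
rewrite nneseries_interchange//; apply: lee_nneseries => [i _ _|i _].
  exact: nneseries_ge0.
apply: variation_partition => [j||]; first exact: measurableI.
  exact: trivIset_setIr.
by rewrite -setI_bigcupl BA; apply/setIidPr => z Az; exists i.
Qed.

Lemma variation_sigma_additive (A : (set C)^nat) :
  (forall i, measurable (A i)) -> trivIset setT A ->
  V (\bigcup_i A i) = \sum_(0 <= i <oo) V (A i).
Proof.
move=> mA tA; apply/eqP; rewrite eq_le variation_subadditive//=.
have mU : measurable (\bigcup_i A i) by exact: bigcupT_measurable.
apply: lime_le; first by apply: is_cvg_nneseries => n _ _; exact: variation_ge0.
apply: nearW => n.
apply: (@le_trans _ _ (V (\big[setU/set0]_(i < n) A i))); last first.
  apply: le_variation => //; first exact: bigsetU_measurable.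
  by move=> z; rewrite -bigcup_mkord => -[i _ Az]; exists i.
elim: n => [|n ih]; first by rewrite big_geq// big_ord0 variation0.
rewrite big_nat_recr//= big_ord_recr/=.
apply: le_trans (variation_superadditive _ _ _) => //.
- by rewrite leeD2r.
- exact: bigsetU_measurable.
- rewrite -bigcup_mkord; apply/seteqP; split=> // z [[i /= ni Az] Anz].
  have := tA i n I I (ex_intro _ z (conj Az Anz)) => ein.
  by rewrite ein ltnn in ni.
Qed.

Lemma cmeasure_tvE A : measurable A -> cmeasure_tv nu A = V A.
Proof.
move=> mA; rewrite /cmeasure_tv /measure_of; case: pselect => [ex|nex].
  by case: cid => mu' /= ->.
exfalso; apply: nex.
(* [V] need not be nonnegative on sets without measurable partitions. *)
pose mu A := if A \in (measurable : set (set C)) then V A else 0.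
have muE A' : measurable A' -> mu A' = V A' by move=> mA'; rewrite /mu mem_set.
have mu0 : mu set0 = 0 by rewrite muE// variation0.
have mu_ge0 A' : 0 <= mu A'.
  by rewrite /mu; case: ifP => // /set_mem; exact: variation_ge0.
have muS : semi_sigma_additive mu.
  move=> F mF tF mUF; rewrite muE// variation_sigma_additive//.
  under eq_fun do under eq_bigr do rewrite muE//.
  by apply: is_cvg_nneseries => n _ _; exact: variation_ge0.
pose mu' : {measure set C -> \bar R} :=
  HB.pack mu (isMeasure.Build _ _ _ mu mu0 mu_ge0 muS).
by exists mu' => A' mA'; rewrite -muE.
Qed.

End Variation.
End TotalVariation.

(** * Measures with a density *)

Section Density.
Variable (R : realType).
Local Notation C := (Cborel R).
Implicit Types (A B D : set C) (nu lam : set C -> R[i]) (h : C -> R[i]).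

Definition cmeasure_restr nu B A := nu (A `&` B).

Lemma is_cmeasure_restr nu B : is_cmeasure nu -> measurable B ->
  is_cmeasure (cmeasure_restr nu B).
Proof.
move=> [nu0 nuS] mB; split; first by rewrite /cmeasure_restr set0I.
move=> A mA tA; rewrite /cmeasure_restr setI_bigcupl.
apply: nuS => [i|]; first exact: measurableI.
exact: trivIset_setIr.
Qed.

Section Finite.
Variable nu : set C -> R[i].
Hypotheses (cnu : is_cmeasure nu)
  (nu_fin : (cmeasure_variation nu setT < +oo)%E).
Local Notation V := (cmeasure_variation nu).

Lemma variation_fin_num A : measurable A -> V A \is a fin_num.
Proof.
move=> mA; rewrite ge0_fin_numE ?variation_ge0//.
by apply: le_lt_trans nu_fin; exact: le_variation.
Qed.

Variables (D : set C) (mD : measurable D).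

Lemma sum_level_le_variation (q : C -> nat) n B : measurable B -> B `<=` D ->
  (forall p, measurable (level D q p)) ->
  \sum_(p < n) modC (nu (level D q p `&` B)) <= fine (V B).
Proof.
move=> mB BD mq; rewrite -lee_fin fineK ?variation_fin_num//.
have tB : trivIset setT (fun p => level D q p `&` B).
  by move=> i j _ _ [z [[[_ /= <-] _] [[_ /= <-] _]]].
have UB : \bigcup_p (level D q p `&` B) = B.
  apply/seteqP; split=> [z [p _ []]//|z Bz].
  by exists (q z) => //; split => //; split => //; exact: BD.
have mqB p : measurable (level D q p `&` B) by exact: measurableI.
apply: le_trans (variation_partition nu mqB tB UB).
rewrite -sumEFin -(big_mkord xpredT (fun p => (modC (nu (level D q p `&` B)))%:E)).
by apply: nneseries_lim_ge => p _ _; rewrite lee_fin modC_ge0.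
Qed.

(** A quantization of [h] has values of modulus at most [e + d] on the parts of
    [B] where it is constant, and those parts are disjoint. *)
Lemma cmeasure_integral_le_variation B h (e : R) : measurable B -> B `<=` D ->
  bounded_cfun_on D h -> 0 <= e -> (forall z, B z -> modC (h z) <= e) ->
  modC (cmeasure_integral (cmeasure_restr nu B) D h) <= e * fine (V B).
Proof.
move=> mB BD bh e0 he.
have cB := is_cmeasure_restr cnu mB.
have [K K0 KP] := cmeasure_integral_le_bound mD (cmeasure_restr nu B).
have v0 : 0 <= fine (V B) by rewrite fine_ge0 ?variation_ge0.
set v := fine (V B) in v0 *.
pose K' := K + v + 1.
have K'0 : 0 < K' by rewrite ltr_pwDr// addr_ge0.
apply/ler_addgt0Pr => t t0; pose d := t / K'.
have d0 : 0 < d by rewrite divr_gt0.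
have [n [q [a [qn mq hq]]]] := quantize mD d0 bh.
have bs : bounded_cfun_on D (simple D q a n) by exact: bounded_cfun_simple.
have bhs : bounded_cfun_on D (fun z => h z - simple D q a n z).
  have := bounded_cfun_lin (-1) bs bh; congr bounded_cfun_on.
  by apply/funext => z; rewrite mulN1r addrC.
have : modC (cmeasure_integral (cmeasure_restr nu B) D
    (fun z => h z - simple D q a n z)) <= d * K.
  by apply: KP => // z Dz; rewrite simpleE ?qn ?hq.
rewrite cmeasure_integralB// cmeasure_integral_simple//.
set I := cmeasure_integral _ _ _; set S := \sum_(p < n) _ => H1.
have H2 : modC S <= (e + d) * v.
  apply: (@le_trans _ _ (\sum_(p < n) (e + d) * modC (nu (level D q p `&` B)))).
    rewrite /S; elim/big_ind2: _ => [|x x' y y' h1 h2|p _].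
    - by rewrite modCR normr0.
    - by rewrite (le_trans (modCD _ _))// lerD.
    rewrite modCM /cmeasure_restr.
    have [->|/set0P[z [[Dz /= qz] Bz]]] := eqVneq (level D q p `&` B) set0.
      by rewrite cnu.1 modCR normr0 !mulr0.
    apply: ler_wpM2r; first exact: modC_ge0.
    have -> : a p = h z + - (h z - a p) by rewrite opprB addrC subrK.
    rewrite (le_trans (modCD _ _))// lerD ?he//.
    by rewrite -qz /modC normrN; exact: hq.
  rewrite -mulr_sumr ler_wpM2l//; first by rewrite addr_ge0// ltW.
  exact: sum_level_le_variation.
have := modCD (I - S) S; rewrite subrK => H3.
have H4 : d * (K + v) <= t.
  rewrite /d mulrAC ler_pdivrMr//; apply: ler_wpM2l; first exact: ltW.
  by rewrite /K' lerDl.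
by move: H1 H2 H3 H4; lra.
Qed.

End Finite.

(** Along a partition the error terms add up to [e] times the variation of
    [nu], because the latter is a measure. *)
Lemma variation_compare nu nu1 nu2 A (c1 c2 e : R) : is_cmeasure nu ->
  is_cmeasure nu1 -> is_cmeasure nu2 ->
  (cmeasure_variation nu setT < +oo)%E -> measurable A ->
  0 <= c1 -> 0 <= c2 -> 0 <= e ->
  (forall B, measurable B -> B `<=` A -> c1 * modC (nu1 B) <=
     c2 * modC (nu2 B) + e * fine (cmeasure_variation nu B)) ->
  (c1%:E * cmeasure_variation nu1 A <=
   c2%:E * cmeasure_variation nu2 A + e%:E * cmeasure_variation nu A)%E.
Proof.
move=> cn c1' c2' nfin mA c10 c20 e0 H.
have v2 B : measurable B -> (0 <= cmeasure_variation nu2 B)%E.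
  by move=> mB; exact: variation_ge0.
have v B : measurable B -> (0 <= cmeasure_variation nu B)%E.
  by move=> mB; exact: variation_ge0.
move: c10; rewrite le_eqVlt => /predU1P[<-|c10].
  by rewrite mul0e adde_ge0// mule_ge0// ?lee_fin ?v ?v2.
rewrite -lee_pdivlMl//; apply: ge_ereal_sup => _ [B [mB tB BA ->]].
have BsA i : B i `<=` A by move=> z Bz; rewrite -BA; exists i.
rewrite lee_pdivlMl// -nneseriesZl; last first.
  by move=> i _; rewrite lee_fin modC_ge0.
apply: (@le_trans _ _ (\sum_(0 <= i <oo)
    (c2%:E * (modC (nu2 (B i)))%:E + e%:E * cmeasure_variation nu (B i)))%E).
  apply: lee_nneseries => [i _ _|i _].
    by rewrite mule_ge0// lee_fin ?modC_ge0 ?ltW.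
  rewrite -[cmeasure_variation nu (B i)]fineK.
    by rewrite -!EFinM -EFinD lee_fin; exact: H.
  exact: variation_fin_num.
rewrite nneseriesD; last 2 first.
- by move=> i _ _; rewrite mule_ge0// lee_fin ?modC_ge0.
- by move=> i _ _; rewrite mule_ge0// ?lee_fin ?v.
rewrite !nneseriesZl; last 2 first.
- by move=> i _; exact: v.
- by move=> i _; rewrite lee_fin modC_ge0.
rewrite -BA (variation_sigma_additive cn)// leeD2r//.
by rewrite lee_wpmul2l ?lee_fin//; exact: variation_partition.
Qed.

Section TotalVariationOfDensity.
Variables (nu lam : set C -> R[i]) (D : set C) (h : C -> R[i]).
Hypotheses (cnu : is_cmeasure nu) (clam : is_cmeasure lam)
  (nu_fin : (cmeasure_variation nu setT < +oo)%E)
  (mD : measurable D) (bh : bounded_cfun_on D h).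
Hypothesis lamE : forall B, measurable B -> B `<=` D ->
  lam B = cmeasure_integral (cmeasure_restr nu B) D h.
Local Notation V := (cmeasure_variation nu).
Local Notation mu := (cmeasure_tv nu).

Lemma density_near a (e : R) B : measurable B -> B `<=` D -> 0 <= e ->
  (forall z, B z -> modC (h z - a) <= e) ->
  modC (lam B - a * nu B) <= e * fine (V B).
Proof.
move=> mB BD e0 he.
have cB := is_cmeasure_restr cnu mB.
have bc : bounded_cfun_on D (fun=> a) by exact: bounded_cfun_cst.
have -> : lam B - a * nu B =
    cmeasure_integral (cmeasure_restr nu B) D (fun z => h z - a).
  rewrite lamE// cmeasure_integralB//; congr (_ - _).
  have b1 := bounded_cfun_indic D (@measurableT _ C).
  have b0 := bounded_cfun_cst D (0 : R[i]).
  have E0 : cmeasure_integral (cmeasure_restr nu B) D (fun=> 0) = 0.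
    have := cmeasure_integralB mD (cmeasure_restr nu B) b0 b0.
    rewrite [RHS]subrr => E0; rewrite -[RHS]E0; apply: eq_cmeasure_integral => z _.
    by rewrite subrr.
  have := cmeasure_integral_lin mD (cmeasure_restr nu B) a b1 b0.
  rewrite cmeasure_integral_indic// E0 addr0 {2}/cmeasure_restr.
  rewrite setTI (setIidr BD) => <-.
  apply: eq_cmeasure_integral => z _.
  by rewrite indicE in_setT mulr1 addr0.
apply: cmeasure_integral_le_variation => //.
have := bounded_cfun_lin (-1) bc bh; congr bounded_cfun_on.
by apply/funext => z; rewrite mulN1r addrC.
Qed.

Local Open Scope ereal_scope.

Let mh : measurable_fun D (fun z => (modC (h z))%:E).
Proof. by apply/measurable_EFinP; exact: measurable_modC. Qed.

(** Both the integral of [modC h] and the variation of [lam] are within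
    [e * V A] of [modC a * V A]. *)
Lemma integral_near a (e : R) A : measurable A -> A `<=` D -> (0 <= e)%R ->
  (forall z, A z -> (modC (h z - a) <= e)%R) ->
  \int[mu]_(z in A) (modC (h z))%:E <=
    cmeasure_variation lam A + (2 * e)%:E * V A /\
  cmeasure_variation lam A <=
    \int[mu]_(z in A) (modC (h z))%:E + (2 * e)%:E * V A.
Proof.
move=> mA AD e0 he.
have mhA : measurable_fun A (fun z => (modC (h z))%:E).
  exact: measurable_funS mh.
have near B : measurable B -> B `<=` A ->
    (modC (lam B - a * nu B) <= e * fine (V B))%R.
  move=> mB BA; apply: density_near => // [z /BA /AD//|z Bz].
  exact/he/BA.
have upper : 1%:E * cmeasure_variation lam A <=
    (modC a)%:E * V A + e%:E * V A.
  apply: (variation_compare cnu) => //; first exact: modC_ge0.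
  move=> B mB BA; rewrite mul1r -modCM; have := near B mB BA.
  by have := modCD (lam B - a * nu B)%R (a * nu B)%R; rewrite subrK; lra.
have lower : (modC a)%:E * V A <= 1%:E * cmeasure_variation lam A + e%:E * V A.
  apply: (variation_compare cnu) => //; first exact: modC_ge0.
  move=> B mB BA; rewrite mul1r -modCM; have := near B mB BA.
  have := modCD (- (lam B - a * nu B))%R (lam B)%R.
  rewrite opprB subrK -opprB /modC !normrN -/(modC _) -/(modC _).
  by rewrite -!/(modC _); lra.
have muA : mu A = V A by exact: cmeasure_tvE.
have int_le : \int[mu]_(z in A) (modC (h z))%:E <= (modC a + e)%:E * V A.
  rewrite -muA -integral_cst//; apply: ge0_le_integral => //.
  - by move=> z _; rewrite lee_fin modC_ge0.
  move=> z Az; rewrite lee_fin.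
  have -> : h z = (a + (h z - a))%R by rewrite addrC subrK.
  by rewrite (le_trans (modCD _ _))// lerD2l; exact: he.
have int_ge : (modC a)%:E * V A <=
    \int[mu]_(z in A) (modC (h z))%:E + e%:E * V A.
  rewrite -muA -!integral_cst// -ge0_integralD//; last first.
    by move=> z _; rewrite lee_fin modC_ge0.
  apply: ge0_le_integral => //.
  - by move=> z _; rewrite lee_fin modC_ge0.
  - exact: emeasurable_funD.
  move=> z Az; rewrite -EFinD lee_fin.
  have {1}-> : a = (h z + - (h z - a))%R by rewrite opprB addrC subrK.
  rewrite (le_trans (modCD _ _))// lerD2l /modC normrN.
  exact: he.
have Vn := variation_fin_num nu_fin mA.
have V0 := variation_ge0 nu mA.
rewrite mul1e in upper lower.
split.
- apply: (le_trans int_le); rewrite EFinD muleDl//.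
  rewrite mulr_natl mulr2n EFinD muleDl// addeA leeD2r//.
- apply: (le_trans upper).
  rewrite mulr_natl mulr2n EFinD muleDl// addeA leeD2r//.
Qed.

(** The two sides almost agree on a set where [h] is almost constant, by
    [integral_near]; finitely many such sets cover [D], and the errors add up to
    a small multiple of [V D]. *)
Lemma integral_modC_tv :
  \int[mu]_(z in D) (modC (h z))%:E = cmeasure_variation lam D.
Proof.
have Vn := variation_fin_num nu_fin mD.
have V0 : 0 <= V D by exact: variation_ge0.
suff H (e : R) : (0 < e)%R ->
    \int[mu]_(z in D) (modC (h z))%:E <=
      cmeasure_variation lam D + (2 * e)%:E * V D /\
    cmeasure_variation lam D <=
      \int[mu]_(z in D) (modC (h z))%:E + (2 * e)%:E * V D.
  have v0 : (0 < fine (V D) + 1)%R by rewrite ltr_pwDr// fine_ge0.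
  have small (t : R) : (0 < t)%R -> exists2 e : R, (0 < e)%R &
      (2 * e)%:E * V D <= t%:E.
    move=> t0; exists (t / 2 / (fine (V D) + 1))%R.
      by rewrite !divr_gt0.
    rewrite -(fineK Vn) -EFinM lee_fin mulrA mulrCA divff// mulr1.
    rewrite mulrAC ler_pdivrMr// ler_wpM2l ?lerDl//.
    exact: ltW.
  apply/eqP; rewrite eq_le; apply/andP; split; apply/lee_addgt0Pr => t t0.
  - have [e e0 et] := small t t0.
    by apply: (le_trans (H e e0).1); rewrite leeD2l.
  - have [e e0 et] := small t t0.
    by apply: (le_trans (H e e0).2); rewrite leeD2l.
move=> e0; have [n [q [a [_ mq hq]]]] := quantize mD e0 bh.
pose A p := level D q p.
have mA p : measurable (A p) by exact: mq.
have tA : trivIset setT A by move=> i j _ _ [z [[_ /= <-] [_ /= <-]]].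
have UA : D = \bigcup_p A p.
  by apply/seteqP; split=> [z Dz|z [p _ []]//]; exists (q z).
have AD p : A p `<=` D by move=> z [].
have near p := @integral_near (a p) e (A p) (mA p) (AD p) (ltW e0).
have near' p : forall z, A p z -> (modC (h z - a p) <= e)%R.
  by move=> z [Dz <-]; exact: hq.
have e20 : 0 <= (2 * e)%:E by rewrite lee_fin mulr_ge0// ltW.
have Vp p : 0 <= V (A p) by exact: variation_ge0.
have Lp p : 0 <= cmeasure_variation lam (A p) by exact: variation_ge0.
have Ip p : 0 <= \int[mu]_(z in A p) (modC (h z))%:E.
  by apply: integral_ge0 => z _; rewrite lee_fin modC_ge0.
have intE : \int[mu]_(z in D) (modC (h z))%:E =
    \sum_(0 <= p <oo) \int[mu]_(z in A p) (modC (h z))%:E.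
  rewrite UA ge0_integral_bigcup// -?UA//.
  by move=> z _; rewrite lee_fin modC_ge0.
rewrite intE UA !variation_sigma_additive//.
rewrite -!nneseriesZl//.
split; rewrite -nneseriesD//.
- by apply: lee_nneseries => p _ => //; exact: (near p (near' p)).1.
- by move=> p _ _; rewrite mule_ge0.
- by apply: lee_nneseries => p _ => //; exact: (near p (near' p)).2.
- by move=> p _ _; rewrite mule_ge0.
Qed.

End TotalVariationOfDensity.
End Density.

(** * Functional calculus of a spectral measure *)

Section FunctionalCalculus.
Variables (R : realType) (V : complexHilbert R).
Local Notation C := (Cborel R).
Variable E : set C -> {linear V -> V}.
Hypothesis sE : spectral_measure E.

Definition coef u v (Om : set C) : R[i] := dotp (E Om u) v.

Lemma spectral_sqr Om u : measurable Om ->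
  dotp (E Om u) u = ((nr (E Om u) ^+ 2)%:C)%C.
Proof.
move=> mO; rewrite -dot_nr [RHS](spec_sym sE)// (spec_setI sE)// setIid.
exact: (spec_sym sE).
Qed.

Lemma spectral_contraction Om u : measurable Om -> nr (E Om u) <= nr u.
Proof.
move=> mO; have := CS (E Om u) u.
rewrite spectral_sqr// modCR ger0_norm ?sqr_ge0// expr2.
have [->|e0] := eqVneq (nr (E Om u)) 0; first by rewrite nr_ge0.
by rewrite ler_pM2l// lt_neqAle eq_sym e0 nr_ge0.
Qed.

Lemma is_cmeasure_coef u v : is_cmeasure (coef u v).
Proof.
split; first by rewrite /coef (spec_set0 sE) dot0l.
move=> A mA tA; rewrite /coef.
rewrite (_ : (fun n => _) = (fun n => dotp (\sum_(i < n) E (A i) u) v)).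
  exact: (@dot_cvgl _ _ _ _ _ _ _ v (spec_sigma_additive sE mA tA (u:=u))).
by apply/funext => n; rewrite dot_suml.
Qed.

(** The partial sums increase to [nr (E (\bigcup_i B i) u) ^+ 2], as
    [coef u u] is a measure. *)
Lemma spectral_bessel (B : (set C)^nat) u n : (forall i, measurable (B i)) ->
  trivIset setT B -> \sum_(i < n) nr (E (B i) u) ^+ 2 <= nr u ^+ 2.
Proof.
move=> mB tB; have mU : measurable (\bigcup_i B i) by exact: bigcupT_measurable.
have h := (is_cmeasure_coef u u).2 _ mB tB.
have h2 : (fun n => \sum_(i < n) nr (E (B i) u) ^+ 2) @ \oo -->
    nr (E (\bigcup_i B i) u) ^+ 2.
  have -> : nr (E (\bigcup_i B i) u) ^+ 2 = complex.Re (coef u u (\bigcup_i B i)).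
    by rewrite /coef spectral_sqr.
  rewrite (_ : (fun n => _) =
      @complex.Re R \o (fun n => \sum_(i < n) coef u u (B i))).
    by apply: continuous_cvg h; exact: continuous_Re.
  apply/funext => k /=; elim/big_ind2: _ => [//|x x' y y' -> ->|i _].
    by rewrite creD.
  by rewrite /coef spectral_sqr.
have nd : nondecreasing_seq (fun n => \sum_(i < n) nr (E (B i) u) ^+ 2).
  apply/nondecreasing_seqP => k; rewrite big_ord_recr/= lerDl.
  exact: sqr_ge0.
have := nondecreasing_cvgn_le nd (cvgP _ h2) n.
rewrite (cvg_lim _ h2)// => /le_trans; apply.
by rewrite ler_sqr ?nnegrE ?nr_ge0// spectral_contraction.
Qed.

(** Since [E Om] is a projection, [<E Om u, v> = <E Om u, E Om v>], and the
    orthogonal components of [u] and of [v] are square summable. *)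
Lemma variation_coef_le u v :
  (cmeasure_variation (coef u v) setT <= (nr u * nr v)%:E)%E.
Proof.
apply: ge_ereal_sup => _ [B [mB tB _ ->]].
apply: lime_le.
  by apply: is_cvg_nneseries => n _ _; rewrite lee_fin modC_ge0.
apply: nearW => n; rewrite sumEFin lee_fin big_mkord.
have term i : modC (coef u v (B i)) <= nr (E (B i) u) * nr (E (B i) v).
  rewrite (_ : coef u v (B i) = dotp (E (B i) u) (E (B i) v)) ?CS//.
  by rewrite /coef -(spec_sym sE)// (spec_setI sE)// setIid.
have [u0|u0] := eqVneq (nr u) 0.
  rewrite u0 mul0r big1// => i _; rewrite /coef (nr_eq0 u0) linear0 dot0l.
  by rewrite modCR normr0.
have [v0|v0] := eqVneq (nr v) 0.
  rewrite v0 mulr0 big1// => i _; rewrite /coef (nr_eq0 v0) dot0r.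
  by rewrite modCR normr0.
have up : 0 < nr u by rewrite lt_neqAle eq_sym u0 nr_ge0.
have vp : 0 < nr v by rewrite lt_neqAle eq_sym v0 nr_ge0.
pose s := nr v / nr u; pose t := nr u / nr v.
have s0 : 0 < s by rewrite divr_gt0.
have t0 : 0 < t by rewrite divr_gt0.
have st : s * t = 1 by rewrite /s /t; field; rewrite u0 v0.
(* The weights [s] and [t] make the bound equal to [nr u * nr v] at the end. *)
have amgm (a b : R) : a * b <= 2^-1 * s * a ^+ 2 + 2^-1 * t * b ^+ 2.
  have : 0 <= 2^-1 * t * (s * a - b) ^+ 2.
    by rewrite mulr_ge0 ?sqr_ge0// mulr_ge0// ltW.
  have -> : 2^-1 * t * (s * a - b) ^+ 2 =
      2^-1 * (s * t) * s * a ^+ 2 - (s * t) * a * b + 2^-1 * t * b ^+ 2.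
    by field.
  by rewrite st; lra.
apply: (@le_trans _ _ (\sum_(i < n) (2^-1 * s * nr (E (B i) u) ^+ 2 +
    2^-1 * t * nr (E (B i) v) ^+ 2))).
  by apply: ler_sum => i _; exact: le_trans (term i) (amgm _ _).
rewrite big_split/= -!mulr_sumr.
have -> : nr u * nr v = 2^-1 * s * nr u ^+ 2 + 2^-1 * t * nr v ^+ 2.
  by rewrite /s /t; field; rewrite u0 v0.
by rewrite lerD// ler_wpM2l ?spectral_bessel// mulr_ge0// ltW.
Qed.

Lemma variation_coef_fin u v :
  (cmeasure_variation (coef u v) setT < +oo)%E.
Proof. by apply: le_lt_trans (variation_coef_le u v) _; exact: ltry. Qed.

Variables (D : set C) (mD : measurable D).
Local Notation Phi m := (oper_integral (fun Om => everywhere (E Om)) D m).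
Local Notation I m u v := (cmeasure_integral (coef u v) D m).

Lemma coef_integral_le m M u v : bounded_cfun_on D m -> 0 <= M ->
  (forall z, D z -> modC (m z) <= M) -> modC (I m u v) <= M * (nr u * nr v).
Proof.
move=> bm M0 mM; have cc := is_cmeasure_coef u v.
have -> : I m u v = cmeasure_integral (cmeasure_restr (coef u v) D) D m.
  apply: (eq_cmeasure_integral_measure mD cc (is_cmeasure_restr cc mD) _ bm).
  by move=> A mA AD; rewrite /cmeasure_restr (setIidl AD).
apply: le_trans (cmeasure_integral_le_variation cc (variation_coef_fin u v) mD
  mD (@subset_refl _ D) bm M0 mM) _.
rewrite ler_wpM2l// -lee_fin fineK ?(variation_fin_num (variation_coef_fin u v))//.
by apply: le_trans (variation_coef_le u v); exact: le_variation.
Qed.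

(** The integral is bounded and conjugate linear in [v], so that the Riesz
    theorem represents it. *)
Lemma functional_calculus_ex m u : bounded_cfun_on D m ->
  exists w, forall v, dotp w v = I m u v.
Proof.
move=> bm; have [M M0 mM] := bounded_cfunP bm.
have [a v1 v2|v|h hP] := @riesz _ _ (fun v => Num.conj (I m u v)) (M * nr u).
- rewrite (@cmeasure_integral_measure_lin _ _ mD _ (coef u v1) (coef u v2)
    (Num.conj a))//; last 4 first.
  + exact: is_cmeasure_coef.
  + exact: is_cmeasure_coef.
  + exact: is_cmeasure_coef.
  + by move=> A mA AD; rewrite /coef dotDr dotZr.
  by rewrite conjcD conjcM conjCK.
- by rewrite modC_conj -mulrA; exact: coef_integral_le.
- by exists h => v; rewrite dotC -hP conjCK.
Qed.

Lemma functional_calculus_dot m u v : bounded_cfun_on D m ->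
  dotp (Phi m u) v = I m u v.
Proof.
move=> bm; have [w wP] := functional_calculus_ex u bm.
rewrite /oper_integral /=; case: xgetP => [w' _ /(_ v) //|/(_ w)[]].
exact: wP.
Qed.

Lemma functional_calculus_linear m a u v : bounded_cfun_on D m ->
  Phi m (a *: u + v) = a *: Phi m u + Phi m v.
Proof.
move=> bm; apply: dot_inj => w.
rewrite dotDl dotZl !functional_calculus_dot//.
apply: (cmeasure_integral_measure_lin mD) => //.
- exact: is_cmeasure_coef.
- exact: is_cmeasure_coef.
- exact: is_cmeasure_coef.
- by move=> A mA AD; rewrite /coef linearP dotDl dotZl.
Qed.

Lemma functional_calculus_bounded m : bounded_cfun_on D m ->
  exists2 M : R, 0 <= M & forall u, nr (Phi m u) <= M * nr u.
Proof.
move=> bm; have [M M0 mM] := bounded_cfunP bm; exists M => // u.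
have := coef_integral_le u (Phi m u) bm M0 mM.
rewrite -functional_calculus_dot// dot_nr modCR ger0_norm ?sqr_ge0//.
have [->|w0] := eqVneq (nr (Phi m u)) 0; first by rewrite mulr_ge0 ?nr_ge0.
by rewrite expr2 mulrA ler_pM2r// lt_neqAle eq_sym w0 nr_ge0.
Qed.

Lemma functional_calculus_spectral m u Om v : measurable Om ->
  bounded_cfun_on D m -> coef (Phi m u) v Om = I m u (E Om v).
Proof. by move=> mO bm; rewrite /coef (spec_sym sE)// functional_calculus_dot. Qed.

Lemma functional_calculus_orthogonal m u k : bounded_cfun_on D m ->
  (forall Om, measurable Om -> dotp (E Om u) k = 0) -> dotp (Phi m u) k = 0.
Proof.
move=> bm uk; rewrite functional_calculus_dot//.
have : I m u k = 1 * I m u k + I m u k.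
  apply: (cmeasure_integral_measure_lin mD) => //.
  - exact: is_cmeasure_coef.
  - exact: is_cmeasure_coef.
  - exact: is_cmeasure_coef.
  - by move=> A mA AD; rewrite /coef uk// mulr0 addr0.
by rewrite mul1r -[LHS]addr0 => /addrI.
Qed.

Lemma coef_integral_functional u v :
  bounded_functional D (fun m => I m u v).
Proof. exact: cmeasure_integral_functional. Qed.

Lemma bounded_functionalM F m : bounded_functional D F ->
  bounded_cfun_on D m -> bounded_functional D (fun h => F (fun z => h z * m z)).
Proof.
move=> [Flin [K K0 KP]] bm; have [M M0 mM] := bounded_cfunP bm; split.
  move=> a h1 h2 b1 b2; rewrite -Flin; [|exact: bounded_cfunM..].
  by congr F; apply/funext => z; rewrite mulrDl mulrA.
exists (M * K) => [|h N bh N0 hN]; first exact: mulr_ge0.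
rewrite mulrA; apply: KP; [exact: bounded_cfunM|exact: mulr_ge0|].
by move=> z Dz; rewrite modCM ler_pM ?modC_ge0 ?hN ?mM.
Qed.

(** Both sides are bounded functionals of [m]; for an indicator function the
    identity is the multiplicativity of [E]. *)
Lemma functional_calculus_indic m A u v : measurable A ->
  bounded_cfun_on D m ->
  I m u (E (A `&` D) v) = I (fun z => m z * ((\1_A z : R)%:C)%C) u v.
Proof.
move=> mA; have mAD : measurable (A `&` D) by exact: measurableI.
have bA := bounded_cfun_indic D mA.
move: m; apply: (bounded_functional_ext mD).
- exact: coef_integral_functional.
- exact: (bounded_functionalM (coef_integral_functional u v) bA).
move=> B mB; have mBD : measurable (B `&` D) by exact: measurableI.
have -> : (fun z => ((\1_B z : R)%:C)%C * ((\1_A z : R)%:C)%C : R[i]) =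
    fun z => ((\1_(A `&` B) z : R)%:C)%C.
  apply/funext => z; rewrite -rmorphM/= !indicE in_setI.
  by case: (_ \in A) (_ \in B) => [] []; rewrite ?mulr1 ?mulr0.
rewrite !(cmeasure_integral_indic mD)//; [|exact: is_cmeasure_coef|
  exact: is_cmeasure_coef|exact: measurableI].
rewrite /coef -(spec_sym sE)// (spec_setI sE)//.
by rewrite setIACA setIid.
Qed.

(** Both sides are bounded functionals of [m1], and [functional_calculus_indic]
    is the case of an indicator function. *)
Lemma functional_calculusM m1 m2 u : bounded_cfun_on D m1 ->
  bounded_cfun_on D m2 -> Phi m1 (Phi m2 u) = Phi (fun z => m1 z * m2 z) u.
Proof.
move=> b1 b2; apply: dot_inj => v.
rewrite !functional_calculus_dot//; last exact: bounded_cfunM.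
move: m1 b1; apply: (bounded_functional_ext mD).
- exact: coef_integral_functional.
- exact: (bounded_functionalM (coef_integral_functional u v) b2).
move=> A mA; have mAD : measurable (A `&` D) by exact: measurableI.
rewrite (cmeasure_integral_indic mD)//; last exact: is_cmeasure_coef.
rewrite functional_calculus_spectral// functional_calculus_indic//.
by congr (cmeasure_integral _ _ _); apply/funext => z; rewrite mulrC.
Qed.

(** As [E B] is self-adjoint and commutes with [E], the coefficient of [Phi m u]
    at [B] is the integral of [m] against the coefficient of [u] restricted to
    [B]: the former measure has density [m] with respect to the latter. *)
Lemma coef_tv m u v : bounded_cfun_on D m ->
  (\int[cmeasure_tv (coef u v)]_(z in D) (modC (m z))%:E =
   cmeasure_variation (coef (Phi m u) v) D)%E.
Proof.
move=> bm; have cu := is_cmeasure_coef u v.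
apply: (integral_modC_tv cu (is_cmeasure_coef _ v) (variation_coef_fin u v) mD bm).
move=> B mB BD; rewrite functional_calculus_spectral//.
apply: (eq_cmeasure_integral_measure mD (is_cmeasure_coef _ _)
  (is_cmeasure_restr cu mB) _ bm).
move=> X mX XD; rewrite /cmeasure_restr /coef -(spec_sym sE)//.
by rewrite (spec_setI sE)// setIC.
Qed.

End FunctionalCalculus.

(** * The nonorthogonal resolution of identity *)

Section Graphs.
Variables (R : realType) (V W : complexHilbert R).

Lemma oeq_ext (T S : oper V W) : odom T = odom S ->
  (forall x, odom T x -> T x = S x) -> T =op S.
Proof.
move=> TS E; apply/seteqP; split=> [[x y] [/= Tx ->]|[x y] [/= Sx ->]].
  by split=> /=; rewrite -?TS ?E.
by split=> /=; rewrite ?TS// E// TS.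
Qed.

Lemma oeq_graph (T S : oper V W) : T =op S ->
  forall x, odom T x -> odom S x /\ T x = S x.
Proof.
move=> TS x Tx; have : graph T (x, T x) by [].
by rewrite TS.
Qed.

End Graphs.

(** A self-adjoint idempotent is a contraction on its domain, so that it
    extends continuously; the extension shows that the adjoint is defined
    everywhere. *)
Lemma selfadjoint_idempotent_everywhere (R : realType) (H : complexHilbert R)
    (T : oper H H) : dense (odom T) -> olinear T ->
  (forall f, odom T f -> odom T (T f) /\ T (T f) = T f) ->
  T =op adjoint T -> odom T = setT.
Proof.
move=> /dense_nrP dT [_ Tlin] TT Tad.
have adj g : odom T g -> adjoint_rel T g (T g).
  move=> Dg; have [[h hP] ->] := oeq_graph Tad Dg.
  by rewrite /adjoint /=; case: xgetP => [h' _ //|/(_ h)].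
have contr f : odom T f -> nr (T f) <= nr f.
  move=> Df; have [DTf TTf] := TT f Df.
  have := adj _ DTf f Df; rewrite TTf dot_nr => /(congr1 (@modC R)).
  rewrite modCR ger0_norm ?sqr_ge0// => h.
  have := CS f (T f); rewrite -h expr2.
  have [->|e0] := eqVneq (nr (T f)) 0; first by rewrite nr_ge0.
  by rewrite ler_pM2r// lt_neqAle eq_sym e0 nr_ge0.
apply/seteqP; split=> // g _.
have /choice[g_ g_P] (n : nat) : exists f, odom T f /\ nr (g - f) < n.+1%:R^-1.
  have n0 : 0 < n.+1%:R^-1 :> R by rewrite invr_gt0.
  by have [f Df gf] := dT g _ n0; exists f.
have Dg n : odom T (g_ n) by have [] := g_P n.
have h0 : (fun n => 2 * n.+1%:R^-1 : R) @ \oo --> (0 : R).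
  rewrite -[X in _ --> X](mulr0 2).
  by apply: cvgM; [exact: cvg_cst|exact: cvg_harmonic].
have gg : g_ @ \oo --> g.
  by apply: (cvg_nr_bound (@cvg_harmonic R)) => n; exact/ltW/(g_P n).2.
have [h hh] : exists h : H, (fun n => T (g_ n)) @ \oo --> h.
  apply: (cauchy_nr_bound h0) => n m nm.
  have [D1 E1] := Tlin (-1) (g_ m) (g_ n) (Dg m) (Dg n).
  have -> : T (g_ n) - T (g_ m) = T (- 1 *: g_ m + g_ n).
    by rewrite E1 scaleN1r addrC.
  rewrite (le_trans (contr _ D1))// scaleN1r addrC.
  rewrite (le_trans (nr_distD g _ _))// mulr_natl mulr2n.
  rewrite lerD//; first by rewrite nr_distC; exact/ltW/(g_P n).2.
  apply: le_trans (ltW (g_P m).2) _.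
  by rewrite lef_pV2 ?posrE// ler_nat.
have : odom (adjoint T) g.
  exists h => f Df; rewrite dotC [RHS]dotC; congr (Num.conj _).
  have c1 := @dot_cvgl _ _ _ _ (@eventually_filter) _ _ (T f) gg.
  have c2 := @dot_cvgl _ _ _ _ (@eventually_filter) _ _ f hh.
  have gT n : dotp (g_ n) (T f) = dotp (T (g_ n)) f.
    by rewrite (adj f Df _ (Dg n)).
  rewrite (_ : (fun n => _) = fun n => dotp (T (g_ n)) f) in c1.
    exact: (cvg_unique (@norm_hausdorff _ R[i]^o) c1 c2).
  by apply/funext => n; exact: gT.
move=> Dag; have : graph (adjoint T) (g, adjoint T g) by [].
by rewrite -Tad => -[].
Qed.

Section Sandwich.
Variables (R : realType) (Ht H : complexHilbert R) (L : {linear Ht -> H}).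
Hypothesis cL : continuous L.
Local Notation Ld := (pseudo_inverse L).

(** In terms of [u = Ld f], the graph of [f |-> (Ld f, L (phi (Ld f)))] is
    given by the closed conditions [L u = f], [u] orthogonal to the kernel of
    [L], and a continuous equation. If [L] is onto then [Ld] is bounded, and so
    is [T]. *)
Lemma sandwich_closed (phi : {linear Ht -> Ht}) (T : oper H H) :
  continuous phi -> odom T = range L ->
  (forall f, range L f -> T f = L (phi (Ld f))) ->
  olinear T /\ closed_relative Ld T.
Proof.
move=> cphi DT TE; have sR := subspace_range L.
have Tlin : olinear T.
  split; first by rewrite DT; exact: sR.1.
  move=> a x y; rewrite DT => Dx Dy.
  have Dxy := sR.2 a x y Dx Dy; split=> //.
  by rewrite !TE// pseudo_inverse_linear// !linearP.
split=> //; split.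
  have -> : [set p : H * (Ht * H) |
            [/\ odom T p.1, p.2.1 = Ld p.1 & p.2.2 = T p.1]] =
      [set p | L p.2.1 - p.1 = 0] `&`
      [set p | coimage L p.2.1] `&` [set p | p.2.2 - L (phi p.2.1) = 0].
    apply/seteqP; split=> [[f [u w]]|[f [u w]]] /=.
      move=> [Df -> ->]; rewrite DT in Df.
      have [h1 h2] := pseudo_inverseP cL Df.
      by rewrite h1 TE// !subrr.
    move=> [[/eqP + uK] /eqP]; rewrite !subr_eq0 => /eqP <- /eqP ->.
    have Df : range L (L u) by exists u.
    split; first by rewrite DT.
      by symmetry; exact: pseudo_inverseK.
    rewrite TE//; congr (L (phi _)); symmetry; exact: pseudo_inverseK.
  have c1 : continuous (fun p : H * (Ht * H) => p.1) by move=> p; exact: cvg_fst.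
  have c21 : continuous (fun p : H * (Ht * H) => p.2.1).
    by move=> p; apply: (cvg_comp (fun q => q.2) fst cvg_snd cvg_fst).
  have c22 : continuous (fun p : H * (Ht * H) => p.2.2).
    by move=> p; apply: (cvg_comp (fun q => q.2) snd cvg_snd cvg_snd).
  have cLu : continuous (fun p : H * (Ht * H) => L p.2.1).
    move=> p; apply: (@continuous_comp _ _ _ (fun p => p.2.1) L p); first exact: c21.
    exact: cL.
  have cpu : continuous (fun p : H * (Ht * H) => phi p.2.1).
    move=> p; apply: (@continuous_comp _ _ _ (fun p => p.2.1) phi p); first exact: c21.
    exact: cphi.
  have cLpu : continuous (fun p : H * (Ht * H) => L (phi p.2.1)).
    move=> p; apply: (@continuous_comp _ _ _ (fun p => phi p.2.1) L p); first exact: cpu.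
    exact: cL.
  apply: closedI; first apply: closedI.
  - apply: closed_zeros => p; apply: cvgB; last exact: c1.
    exact: cLu.
  - apply: (@preimage_closed _ _ (fun p => p.2.1) (coimage L)) => [p _|].
      exact: c21.
    exact: closed_coimage.
  - apply: closed_zeros => p; apply: cvgB; first exact: c22.
    exact: cLpu.
move=> TT; have LT : range L = setT by rewrite -DT.
have [M M0 LdM] := pseudo_inverse_bounded cL LT.
have [N N0 phiN] := linear_bounded cphi.
have [K K0 LK] := linear_bounded cL.
have Tl : linear (T : H -> H).
  by move=> a x y; apply: (Tlin.2 a x y _ _).2; rewrite TT.
pose T' : {linear H -> H} := HB.pack (T : H -> H) (GRing.isLinear.Build _ _ _ _ _ Tl).
have cT : continuous T'.
  apply: (@bounded_linear _ _ _ _ (K * N * M)) => x.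
  rewrite /= TE; last by rewrite LT.
  rewrite (le_trans (LK _))// -mulrA -mulrA ler_wpM2l ?(ltW K0)//.
  by rewrite (le_trans (phiN _))// ler_wpM2l ?(ltW N0).
rewrite /closed_oper.
have -> : graph T = [set p | p.2 - T' p.1 = 0].
  apply/seteqP; split=> [[x y] [/= _ ->]|[x y] /= /eqP].
    by rewrite subrr.
  by rewrite subr_eq0 => /eqP ->; split=> //; rewrite /= TT.
apply: closed_zeros => p; apply: cvgB; first exact: cvg_snd.
by apply: (@continuous_comp _ _ _ fst T' p); [exact: cvg_fst|exact: cT].
Qed.

End Sandwich.

Section Family.
Variables (R : realType) (Ht H : complexHilbert R).
Variables (E : set (Cborel R) -> {linear Ht -> Ht}) (L : {linear Ht -> H}).
Hypotheses (cL : continuous L) (dL : dense (range L)) (sE : spectral_measure E).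
Hypothesis properE : forall Om : set (Cborel R), measurable Om ->
  E Om @` closure (range (adjoint (everywhere L)))
    `<=` closure (range (adjoint (everywhere L))).
Local Notation Ls := (adjoint (everywhere L)).
Local Notation Ld := (pseudo_inverse L).
Local Notation F := (nsa_family E L).

Lemma spectral_coimage Om u : measurable Om -> coimage L u ->
  coimage L (E Om u).
Proof.
by move=> mO; rewrite coimageE// => uK; apply: properE mO _ _; exists u.
Qed.

Lemma nsa_familyE Om f : F Om f = L (E Om (Ld f)).
Proof. by []. Qed.

Lemma odom_nsa_family Om : odom (F Om) = range L.
Proof. by apply/seteqP; split=> [f [[]]|f fL]//; do 2 split. Qed.

(** The middle factor [Ld L] in [F Om1 (F Om2 f)] acts as the identity, because
    [E Om2] preserves the coimage of [L]. *)
Lemma nsa_familyM Om1 Om2 : measurable Om1 -> measurable Om2 ->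
  ocomp (F Om1) (F Om2) =op F (Om1 `&` Om2).
Proof.
move=> m1 m2.
have FR f : range L (F Om2 f) by exists (E Om2 (Ld f)).
apply: oeq_ext => [|f [Df _]].
  apply/seteqP; split=> [f []//|f Df]; split; first by rewrite odom_nsa_family -(odom_nsa_family (Om1 `&` Om2)).
  by rewrite odom_nsa_family; exact: FR.
rewrite odom_nsa_family in Df; have [_ fK] := pseudo_inverseP cL Df.
rewrite -[LHS]/(F Om1 (F Om2 f)) !nsa_familyE pseudo_inverseK//.
  by rewrite (spec_setI sE).
exact: spectral_coimage.
Qed.

Lemma nsa_family_sandwich Om : measurable Om ->
  olinear (F Om) /\ closed_relative Ld (F Om).
Proof.
move=> mO; apply: (sandwich_closed cL (phi := E Om)) => //.
- exact: (spec_cont sE).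
- exact: odom_nsa_family.
Qed.

Lemma nsa_family_resolution : resolution_of_identity (range L) F.
Proof.
split=> //.
- by move=> Om _; exact: odom_nsa_family.
- by move=> Om mO; exact: (nsa_family_sandwich mO).1.
- apply: oeq_ext => [|f _]; first exact: odom_nsa_family.
  by rewrite nsa_familyE (spec_set0 sE) linear0.
- apply: oeq_ext => [|f]; first exact: odom_nsa_family.
  rewrite odom_nsa_family => Df.
  by rewrite nsa_familyE (spec_setT sE) (pseudo_inverseP cL Df).1.
- move=> Om1 Om2 m1 m2; split; first exact: nsa_familyM.
  by rewrite setIC; exact: nsa_familyM.
- move=> A mA tA f Df; rewrite nsa_familyE.
  rewrite (_ : (fun n => _) = L \o (fun n => \sum_(i < n) E (A i) (Ld f))).
    apply: continuous_cvg; first exact: cL.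
    exact: (spec_sigma_additive sE mA tA).
  by apply/funext => n; rewrite /= linear_sum.
Qed.

Lemma nsa_family_nsa : nsa_resolution Ld (range L) F.
Proof.
split=> //.
- rewrite /closed_oper graph_pseudo_inverse//.
  have -> : [set p : H * Ht | L p.2 = p.1 /\ coimage L p.2] =
      [set p | L p.2 - p.1 = 0] `&` [set p | coimage L p.2].
    apply/seteqP; split=> [[f u] /= [-> uK]|[f u] /= [/eqP + uK]].
      by rewrite subrr.
    by rewrite subr_eq0 => /eqP ->.
  apply: closedI.
    apply: closed_zeros => p; apply: cvgB; last exact: cvg_fst.
    by apply: (@continuous_comp _ _ _ snd L p); [exact: cvg_snd|exact: cL].
  apply: (@preimage_closed _ _ (fun p : H * Ht => p.2) (coimage L)) => [p _|].
    exact: cvg_snd.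
  exact: closed_coimage.
- exact: nsa_family_resolution.
move=> Om mO; split; first exact: (nsa_family_sandwich mO).2.
move=> DnT Fad; apply: DnT; rewrite -(odom_nsa_family Om).
apply: selfadjoint_idempotent_everywhere Fad.
- by rewrite odom_nsa_family.
- exact: (nsa_family_sandwich mO).1.
move=> f Df; have FF := nsa_familyM mO mO; rewrite setIid in FF.
have Dff : odom (ocomp (F Om) (F Om)) f.
  split=> //; rewrite odom_nsa_family; by exists (E Om (Ld f)).
have [_ h] := oeq_graph FF Dff.
by split; [exact: Dff.2|exact: h].
Qed.

Lemma matrix_coeff_nsa f g :
  matrix_coeff F f g = coef E (Ld f) (Ls g).
Proof. by apply/funext => Om; rewrite /matrix_coeff /coef -adjointE. Qed.

Variables (D : set (Cborel R)) (mD : measurable D).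
Local Notation C := (Cborel R).
Local Notation Phi m := (oper_integral (fun Om => everywhere (E Om)) D m).
Local Notation intF m := (oper_integral F D m).

Lemma nsa_integral_dot (m : C -> C) f g : bounded_cfun_on D m ->
  dotp (L (Phi m (Ld f))) g =
  cmeasure_integral (matrix_coeff F f g) D m.
Proof.
move=> bm; rewrite adjointE// matrix_coeff_nsa.
exact: functional_calculus_dot.
Qed.

Lemma nsa_integralE (m : C -> C) f : bounded_cfun_on D m ->
  intF m f = L (Phi m (Ld f)).
Proof.
move=> bm; rewrite {1}/oper_integral /=; case: xgetP => [w _ wP|/(_ (L (Phi m (Ld f))))[]].
  by apply: dot_inj => g; rewrite wP nsa_integral_dot.
by move=> g; exact: nsa_integral_dot.
Qed.

Lemma odom_nsa_integral (m : C -> C) : bounded_cfun_on D m ->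
  odom (intF m) = range L.
Proof.
move=> bm; apply/seteqP; split=> [f [/(_ setT measurableT)]|f Df].
  by rewrite odom_nsa_family.
split; first by move=> Om _; rewrite odom_nsa_family.
by exists (L (Phi m (Ld f))) => g; exact: nsa_integral_dot.
Qed.

Lemma nsa_integral_sandwich (m : C -> C) : bounded_cfun_on D m ->
  olinear (intF m) /\ closed_relative Ld (intF m).
Proof.
move=> bm.
have Pl : linear (Phi m : Ht -> Ht).
  by move=> a u v; exact: functional_calculus_linear.
pose phi : {linear Ht -> Ht} :=
  HB.pack (Phi m : Ht -> Ht) (GRing.isLinear.Build _ _ _ _ _ Pl).
have [M _ PM] := functional_calculus_bounded sE mD bm.
apply: (sandwich_closed cL (phi := phi)).
- exact: (@bounded_linear _ _ _ phi M).
- exact: odom_nsa_integral.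
- by move=> f _; exact: nsa_integralE.
Qed.

(** The spectral projections preserve the coimage, so that the measure
    [dotp (E Om u) k] vanishes for all [k] in the kernel. *)
Lemma functional_calculus_coimage (m : C -> C) u : bounded_cfun_on D m ->
  coimage L u -> coimage L (Phi m u).
Proof.
move=> bm uK k k0; apply: functional_calculus_orthogonal => // Om mO.
exact: spectral_coimage.
Qed.

Lemma nsa_integralM (m1 m2 : C -> C) : bounded_cfun_on D m1 ->
  bounded_cfun_on D m2 ->
  ocomp (intF m1) (intF m2) =op intF (fun z => (m1 z : R[i]) * (m2 z : R[i])).
Proof.
move=> b1 b2; have b12 := bounded_cfunM b1 b2.
apply: oeq_ext => [|f [Df _]].
  apply/seteqP; split=> [f [Df _]|f Df].
    by rewrite odom_nsa_integral// -(odom_nsa_integral b2).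
  rewrite odom_nsa_integral// in Df.
  split; first by rewrite odom_nsa_integral.
  by rewrite odom_nsa_integral// nsa_integralE//; exists (Phi m2 (Ld f)).
rewrite odom_nsa_integral// in Df; have [_ fK] := pseudo_inverseP cL Df.
rewrite -[LHS]/(intF m1 (intF m2 f)) !nsa_integralE// pseudo_inverseK//.
  by rewrite functional_calculusM.
exact: functional_calculus_coimage.
Qed.

Lemma nsa_integral_tv (m : C -> C) f g : bounded_cfun_on D m -> range L f ->
  (\int[cmeasure_tv (matrix_coeff F f g)]_(z in D) (modC (m z))%:E =
   \int[cmeasure_tv (matrix_coeff F (L (Phi m (Ld f))) g)]_(z in D) 1)%E.
Proof.
move=> bm Df; have [_ fK] := pseudo_inverseP cL Df.
have E2 : matrix_coeff F (L (Phi m (Ld f))) g = coef E (Phi m (Ld f)) (Ls g).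
  rewrite matrix_coeff_nsa; congr (coef E _ _); apply: (pseudo_inverseK cL).
  exact: functional_calculus_coimage.
rewrite E2 matrix_coeff_nsa (coef_tv sE mD _ _ bm).
rewrite (integral_cst _ mD 1%E) mul1e cmeasure_tvE//.
exact: is_cmeasure_coef.
Qed.

End Family.

Theorem lemma4p3 (R : realType) (Ht H : complexHilbert R) (A : oper Ht Ht)
    (E : set (Cborel R) -> {linear Ht -> Ht}) (L : {linear Ht -> H})
    (data : operator_data A L)
    (specE : spectral_measure_of A E)
    (properE : forall Om : set (Cborel R), measurable Om ->
       E Om @` closure (range (adjoint (everywhere L)))
         `<=` closure (range (adjoint (everywhere L)))) :
  let Ls := adjoint (everywhere L) in
  let Ld := pseudo_inverse L in
  let F := nsa_family E L in
  let sigma : set (Cborel R) := spectrum A in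
  let mA m := oper_integral (fun Om => everywhere (E Om)) sigma m in
  let intF m := oper_integral F sigma m in
  nsa_resolution Ld (range L) F /\
  (forall f g, range L f ->
     [/\ is_cmeasure (matrix_coeff F f g),
         (cmeasure_variation (matrix_coeff F f g) setT < +oo)%E
       & forall Om, measurable Om ->
           matrix_coeff F f g Om = dotp (E Om (Ld f)) (Ls g)]) /\
  (forall m, bounded_borel sigma m ->
     let is_intF (T : oper H H) :=
       [/\ odom T = range L, dense (odom T), olinear T, closed_relative Ld T
         & forall f g, range L f ->
             dotp (T f) g = dotp (L (mA m (Ld f))) g /\
             dotp (L (mA m (Ld f))) g =
               cmeasure_integral (matrix_coeff F f g) sigma m] in
     is_intF (intF m) /\ forall T, is_intF T -> T =op intF m) /\
  (forall m f g, bounded_borel sigma m -> range L f ->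
     (\int[cmeasure_tv (matrix_coeff F f g)]_(z in sigma)
        (modC (m z))%:E =
      \int[cmeasure_tv (matrix_coeff F (L (mA m (Ld f))) g)]_(z in sigma)
        1)%E) /\
  (forall m1 m2, bounded_borel sigma m1 -> bounded_borel sigma m2 ->
     ocomp (intF m1) (intF m2) =op
     intF (fun z => (m1 z : R[i]) * (m2 z : R[i]))).
Proof.
move=> Ls Ld F sigma mA intF.
have cL := operator_data_continuous data.
have dL := operator_data_dense data.
have [sE _ _] := specE.
have mD : measurable sigma := measurable_spectrum A.
have bcf m (bm : bounded_borel sigma m) := bounded_borel_cfun mD bm.
split; first exact: nsa_family_nsa.
split.
  move=> f g _; rewrite matrix_coeff_nsa//; split=> //.
  - exact: is_cmeasure_coef.
  - exact: variation_coef_fin.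
split.
  move=> m /bcf bm is_intF.
  have ok : is_intF (intF m).
    have [Tlin Tcl] := nsa_integral_sandwich cL sE mD bm.
    have DT := odom_nsa_integral cL sE mD bm.
    split=> //; first by rewrite DT.
    move=> f g Df; rewrite -nsa_integral_dot//.
    by rewrite nsa_integralE.
  split=> // T [DT _ _ _ TE]; have [DI _ _ _ IE] := ok.
  apply: oeq_ext => [|f]; first by rewrite DT DI.
  rewrite DT => Df; apply: dot_inj => g.
  by rewrite (TE f g Df).1 (IE f g Df).1.
split; first by move=> m f g /bcf bm Df; exact: nsa_integral_tv.
by move=> m1 m2 /bcf b1 /bcf b2; exact: nsa_integralM.
Qed.
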